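(* Let $A,B,C\subset\mathbb{R}$ be compact sets with $\dim_{\mathcal H}(A)+\dim_{\mathcal H}(B)+\dim_{\mathcal H}(C)>2$. Then the set $$A(B+C)=\{a(b+c):a\in A,\ b\in B,\ c\in C\}\subset\mathbb{R}$$ has positive Lebesgue measure. The dimensional threshold $2$ is in general sharp: there exist compact sets $A,B,C\subset\mathbb{R}$ with $\dim_{\mathcal H}(A)+\dim_{\mathcal H}(B)+\dim_{\mathcal H}(C)=2$ such that $A(B+C)$ has Lebesgue measure zero.
   Context: $\dim_{\mathcal H}$ denotes Hausdorff dimension. *)

(* Defs.v *)
From HB Require Import structures.
From mathcomp Require Import all_boot all_order all_algebra.
From mathcomp Require Import all_classical all_reals all_analysis.

Set Implicit Arguments.
Unset Strict Implicit.
Unset Printing Implicit Defensive.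

Import Order.TTheory GRing.Theory Num.Theory.
Import numFieldNormedType.Exports.

Local Open Scope classical_set_scope.
Local Open Scope ring_scope.

Section HausdorffDimension.
Context {R : realType} {V : normedModType R}.
Implicit Types (A U : set V) (s delta : R).

(* [diameter set0 = -oo], the supremum of the empty set. *)
Definition diameter U : \bar R :=
  ereal_sup [set (`|x - y|)%:E | x in U & y in U].

(* diam(U)^s, with the empty set contributing 0 and 0^0 = 1 on points, so that
   the 0-dimensional measure is the counting measure. *)
Definition diameter_pow s U : \bar R :=
  if U == set0 then 0%E else (diameter U `^ s)%E.

Definition delta_cover delta A : set (set V)^nat :=
  [set U : (set V)^nat | (forall i, (diameter (U i) <= delta%:E)%E) /\
                         A `<=` \bigcup_i U i].

Definition hausdorff_premeasure s delta A : \bar R :=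
  ereal_inf [set (\sum_(i <oo) diameter_pow s (U i))%E
            | U in delta_cover delta A].

(* The premeasure is nonincreasing in delta, so its limit as delta -> 0+ is
   its supremum over delta > 0. *)
Definition hausdorff_measure s A : \bar R :=
  ereal_sup [set hausdorff_premeasure s delta A
            | delta in [set delta | 0 < delta]].

(* With this convention the empty set has dimension 0. *)
Definition hausdorff_dim A : \bar R :=
  ereal_inf [set s%:E | s in [set s | 0 <= s /\ hausdorff_measure s A = 0%E]].

End HausdorffDimension.

Definition mul_add_set {R : realType} (A B C : set R) : set R :=
  [set x | exists a b c, [/\ A a, B b, C c & x = a * (b + c)]].

(* Main.v *)
Require Import Defs.
From HB Require Import structures.
From mathcomp Require Import all_boot all_order all_algebra.
From mathcomp Require Import all_classical all_reals all_analysis.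
From mathcomp Require Import measurable_realfun complex.
From mathcomp Require Import ring lra zify.
Import Order.TTheory GRing.Theory Num.Theory.
Import numFieldNormedType.Exports.
Local Open Scope classical_set_scope.
Local Open Scope ring_scope.

(** Positivity.  Choose exponents sA, sB, sC strictly below the three dimensions
    and still with sum above 2.  For every scale 1/q, q = 2^N, a discrete form of
    Frostman's lemma ([discrete_frostman]) gives finite weights alpha, beta, gamma
    on the cells of length 1/q that meet A, B, C; their total masses are bounded
    below uniformly in N, and an interval of length 2^-j has mass at most a constant
    times 2^(-j sA), resp. 2^(-j sB), 2^(-j sC).  Let sigma be the image of
    alpha x beta x gamma under (a, b, c) |-> a (b + c).  The heart of the proof is
    the energy bound ([close_pairs_product_le])

      (sigma x sigma) (|x - y| <= 1/q) <= E / q,   with E independent of N.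

    By Cauchy-Schwarz over the intervals of length 1/q that carry sigma, at least a
    constant times q of them are needed ([mass_sqr_le_measure_energy]).  They all lie
    within O(1/q) of the compact set A(B+C), so every open set containing A(B+C) has
    measure bounded below, and A(B+C) is not null by outer regularity.

    The energy is at most (8/q) times the sum of |sigma^(k)|^2 over 0 <= k < q
    ([close_pairs_le]).  Since sigma^(k) is the alpha-average of beta^(ak) gamma^(ak),
    Cauchy-Schwarz gives

      |sigma^(k)|^2 <= (sum_a alpha_a |beta^(ak)|^2) (sum_a alpha_a |gamma^(ak)|^2).

    Both factors are estimated by one large sieve inequality ([large_sieve]), which
    bounds the sum of |beta^|^2 over a weighted set of frequencies of size O(R) by
    O(R^(1 - sB)) times the largest weight of a unit window of frequencies.  For k of
    size R = 2^j the frequencies ak, weighted by alpha, put mass at most O(R^-sA) in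
    a unit window, so the first factor is O(R^(1 - sA - sB)) for each k
    ([averaged_exp_sum_le]).  For fixed a the frequencies ak are separated as k
    varies, provided that a stays away from 0, so the second factor summed over k is
    O(R^(1 - sC)) ([summed_exp_sum_le]).  Hence the dyadic block k ~ R contributes
    O(R^(2 - sA - sB - sC)), and the blocks form a convergent geometric series.

    All measures live on the grid of mesh 1/q and all frequencies are integers, so
    the Fourier analysis takes place in a finite cyclic group: the integrals are
    finite sums and Parseval's identity is the orthogonality of roots of unity.

    Sharpness.  Take A = {0} and B = C = [0,1]: the dimensions are 0, 1, 1 and
    A(B+C) = {0}. *)

(** * Squared moduli of complex sums *)

Section ComplexModulus.
Local Open Scope complex_scope.
Context {R : realType}.
Implicit Types (z : R[i]) (x y : R).

Definition sqn z : R := complex.Re z ^+ 2 + complex.Im z ^+ 2.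

Definition ei x : R[i] := cos x +i* sin x.

Lemma sqn_ge0 z : 0 <= sqn z.
Proof. by rewrite addr_ge0 ?sqr_ge0. Qed.

Lemma sqnM z1 z2 : sqn (z1 * z2) = sqn z1 * sqn z2.
Proof. by case: z1 z2 => [a b] [c d]; rewrite /sqn /=; ring. Qed.

Lemma sqnJ z : sqn (conjc z) = sqn z.
Proof. by case: z => a b; rewrite /sqn /= sqrrN. Qed.

Lemma sqn_real x : sqn x%:C = x ^+ 2.
Proof. by rewrite /sqn /= expr0n addr0. Qed.

Lemma sqn_nat n : sqn n%:R = n%:R ^+ 2 :> R.
Proof. by rewrite -(rmorph_nat (real_complex R)) sqn_real. Qed.

Lemma eiD x y : ei (x + y) = ei x * ei y.
Proof.
rewrite /ei cosD sinD; apply/eqP; rewrite eq_complex /=; apply/andP.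
by split; apply/eqP; ring.
Qed.

Lemma conjcM z1 z2 : conjc (z1 * z2) = conjc z1 * conjc z2.
Proof. exact: rmorphM. Qed.

Lemma conjc_sum (I : Type) (r : seq I) (P : pred I) (F : I -> R[i]) :
  conjc (\sum_(i <- r | P i) F i) = \sum_(i <- r | P i) conjc (F i).
Proof. exact: rmorph_sum. Qed.

Lemma ei0 : ei 0 = 1.
Proof. by rewrite /ei cos0 sin0. Qed.

Lemma eiN x : ei (- x) = conjc (ei x).
Proof. by rewrite /ei cosN sinN. Qed.

Lemma sqn_ei x : sqn (ei x) = 1.
Proof. by rewrite /sqn /= cos2Dsin2. Qed.

Lemma ReD z1 z2 : complex.Re (z1 + z2) = complex.Re z1 + complex.Re z2.
Proof. by case: z1 z2 => [a b] [c d]. Qed.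

Lemma ImD z1 z2 : complex.Im (z1 + z2) = complex.Im z1 + complex.Im z2.
Proof. by case: z1 z2 => [a b] [c d]. Qed.

Lemma Re_sum (I : Type) (r : seq I) (P : pred I) (F : I -> R[i]) :
  complex.Re (\sum_(i <- r | P i) F i) = \sum_(i <- r | P i) complex.Re (F i).
Proof. exact: (big_morph _ ReD). Qed.

Lemma Im_sum (I : Type) (r : seq I) (P : pred I) (F : I -> R[i]) :
  complex.Im (\sum_(i <- r | P i) F i) = \sum_(i <- r | P i) complex.Im (F i).
Proof. exact: (big_morph _ ImD). Qed.

Lemma sqnE z : (sqn z)%:C = z * conjc z.
Proof.
case: z => a b; apply/eqP; rewrite eq_complex /sqn /=.
by apply/andP; split; apply/eqP; ring.
Qed.

Lemma sqn_sum (I : finType) (F : I -> R[i]) :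
  sqn (\sum_i F i) = \sum_i \sum_j complex.Re (F i * conjc (F j)).
Proof.
rewrite /sqn Re_sum Im_sum !expr2 !big_distrlr /= -big_split /=.
apply: eq_bigr => i _; rewrite -big_split /=; apply: eq_bigr => j _.
by case: (F i) (F j) => [a b] [c d] /=; ring.
Qed.

(** Twice the difference of the two sides is the sum over all pairs (i, j) of
    w i * w j times the squared modulus of u i * conj (v j) - u j * conj (v i). *)
Lemma cauchy_schwarz_weighted (I : finType) (w : I -> R) (u v : I -> R[i]) :
  (forall i, 0 <= w i) ->
  sqn (\sum_i (w i)%:C * (u i * v i)) <=
  (\sum_i w i * sqn (u i)) * (\sum_i w i * sqn (v i)).
Proof.
move=> w0; rewrite sqn_sum big_distrlr /=.
rewrite -(ler_pM2l (ltr0Sn R 1)) !mulr_sumr.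
set L := (X in X <= _); set T := (X in _ <= X).
have -> : T = \sum_i \sum_j w i * w j *
    (sqn (u i) * sqn (v j) + sqn (u j) * sqn (v i)).
  rewrite {}/T.
  under [RHS]eq_bigr do under eq_bigr do rewrite mulrDr.
  under [RHS]eq_bigr do rewrite big_split.
  rewrite /= big_split /= [X in _ = _ + X]exchange_big /= -big_split /=.
  apply: eq_bigr => i _; rewrite -big_split /= mulr_sumr.
  by apply: eq_bigr => j _; ring.
rewrite {}/L ler_sum// => i _; rewrite mulr_sumr ler_sum// => j _.
have : 0 <= w i * w j * sqn (u i * conjc (v j) - u j * conjc (v i)).
  by rewrite !mulr_ge0 ?sqn_ge0.
rewrite /sqn; case: (u i) (u j) (v i) (v j) => [a b] [c d] [e f] [g h] /=.
by rewrite -subr_ge0; set y := (X in 0 <= X -> _);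
   set z := (X in _ -> 0 <= X); suff -> : y = z by []; rewrite /y /z; ring.
Qed.

Lemma sqn_jensen (I : finType) (w : I -> R) (u : I -> R[i]) :
  (forall i, 0 <= w i) ->
  sqn (\sum_i (w i)%:C * u i) <= (\sum_i w i) * (\sum_i w i * sqn (u i)).
Proof.
move=> w0; have := cauchy_schwarz_weighted _ w u (fun=> 1) w0.
under eq_bigr do rewrite mulr1.
by under [X in _ * X]eq_bigr do rewrite (sqn_nat 1) expr1n mulr1; rewrite mulrC.
Qed.

(** Phases of modulus at most an eighth of a turn do not cancel; this is the only
    quantitative fact about the exponential that the estimates below use. *)
Lemma cos_ge_half x : `|x| <= pi / 4 -> 2^-1 <= cos x.
Proof.
move=> xpi; rewrite -cos_norm.
have pi0 := @pi_gt0 R.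
have c4 : 0 < cos (pi / 4 : R) by apply: cos_gt0_pihalf; apply/andP; split; lra.
have c42 : cos (pi / 4 : R) ^+ 2 = 2^-1.
  have := cos_mulr2n (pi / 4 : R).
  rewrite (_ : pi / 4 *+ 2 = pi / 2); last by field.
  by rewrite cos_pihalf mulr2n; lra.
have c4h : 2^-1 <= cos (pi / 4 : R) by nra.
apply: (le_trans c4h); rewrite le_eqVlt.
move: xpi; rewrite le_eqVlt => /orP[/eqP ->|xpi]; first by rewrite eqxx.
rewrite ltr_cos ?xpi ?orbT// in_itv/=; apply/andP; split; rewrite ?normr_ge0//; lra.
Qed.

End ComplexModulus.
Arguments ei {R} x : simpl never.

(** * Characters of a finite cyclic group *)

Section FiniteFourier.
Local Open Scope complex_scope.
Context {R : realType}.
Variable Q : nat.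
Hypothesis Q0 : (0 < Q)%N.

Definition freq : R := pi *+ 2 / Q%:R.

Definition chr (x : R) : R[i] := ei (freq * x).
Arguments chr x : simpl never.

Let Qr0 : 0 < Q%:R :> R. Proof. by rewrite ltr0n. Qed.

Lemma chrD x y : chr (x + y) = chr x * chr y.
Proof. by rewrite /chr mulrDr eiD. Qed.

Lemma chrN x : chr (- x) = conjc (chr x).
Proof. by rewrite /chr mulrN eiN. Qed.

Lemma chr0 : chr 0 = 1.
Proof. by rewrite /chr mulr0 ei0. Qed.

Lemma sqn_chr x : sqn (chr x) = 1.
Proof. exact: sqn_ei. Qed.

Lemma chrM x (n : nat) : chr (n%:R * x) = chr x ^+ n.
Proof.
elim: n => [|n IHn]; first by rewrite mul0r chr0 expr0.
by rewrite -natr1 mulrDl mul1r chrD IHn exprSr.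
Qed.

Lemma Re_chr_ge x : `|x| * 8 <= Q%:R -> 2^-1 <= complex.Re (chr x).
Proof.
move=> xQ; rewrite /chr /ei /=; apply: cos_ge_half.
have pi0 := @pi_gt0 R.
have f0 : 0 <= freq by rewrite divr_ge0 ?ler0n// mulrn_wge0// pi_ge0.
rewrite normrM (ger0_norm f0) /freq mulrAC ler_pdivrMr// mulr2n; nra.
Qed.

Lemma chr_period (n : nat) : chr n%:R ^+ Q = 1.
Proof.
rewrite -chrM /chr mulrA /freq divfK ?gt_eqF//.
rewrite mulr_natr /ei -{1}[_ *+ n]add0r -{2}[_ *+ n]add0r.
by rewrite (periodicn (@cosD2pi R)) (periodicn (@sinD2pi R)) cos0 sin0.
Qed.

Lemma chr_neq1 (n : nat) : (0 < n < Q)%N -> chr n%:R != 1.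
Proof.
move=> /andP[n0 nQ]; rewrite /chr /ei eq_complex /= negb_and; apply/orP; left.
have pi0 := @pi_gt0 R.
set h := pi * n%:R / Q%:R : R.
have -> : freq * n%:R = h *+ 2 by rewrite /freq /h !mulr2n; field; rewrite ?gt_eqF.
have h0 : 0 < sin h.
  apply: sin_gt0_pi; rewrite /h !(divr_gt0, mulr_gt0) ?ltr0n//=.
  by rewrite ltr_pdivrMr// ltr_pM2l// ltr_nat.
by rewrite cos_mulr2n cos2sin2 lt_eqF// mulr2n; nra.
Qed.

(** The sum is a geometric progression of ratio a Q-th root of unity other than 1. *)
Lemma chr_orthogonal (m n : nat) : (m < Q)%N -> (n < Q)%N ->
  \sum_(v < Q) chr (v%:R * m%:R) * conjc (chr (v%:R * n%:R)) =
  (if m == n then Q%:R else 0).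
Proof.
have geom k l : (k < l)%N -> (l < Q)%N ->
    \sum_(v < Q) chr (v%:R * l%:R) * conjc (chr (v%:R * k%:R)) = 0.
  move=> kl lQ.
  have d0 : (0 < l - k < Q)%N by rewrite subn_gt0 kl (leq_ltn_trans _ lQ)// leq_subr.
  transitivity (\sum_(v < Q) chr (l - k)%:R ^+ v).
    by apply: eq_bigr => v _; rewrite -chrN -chrD -mulrBr natrB ?(ltnW kl)// chrM.
  have := subrX1 (chr (l - k)%:R) Q; rewrite chr_period subrr => /esym/eqP.
  by rewrite mulf_eq0 subr_eq0 (negbTE (chr_neq1 _ d0)) => /eqP.
move=> mQ nQ; have [->|/eqP mn] := eqVneq m n.
  rewrite -[Q in RHS]card_ord -sum1_card natr_sum; apply: eq_bigr => v _.
  by rewrite -sqnE sqn_chr.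
have [?|?|//] := ltngtP m n; last exact: geom.
rewrite -[LHS]conjcK conjc_sum.
under eq_bigr => v _ do rewrite conjcM conjcK mulrC.
by rewrite geom// conjc0.
Qed.

Lemma Re_mul_conj_le (z1 z2 : R[i]) (b1 b2 : R) : 0 <= b1 -> 0 <= b2 ->
  sqn z1 <= b1 ^+ 2 -> sqn z2 <= b2 ^+ 2 -> complex.Re (z1 * conjc z2) <= b1 * b2.
Proof.
move=> b10 b20 h1 h2.
have b0 : 0 <= b1 * b2 by rewrite mulr_ge0.
rewrite (le_trans (ler_norm _))// -(@ler_pXn2r _ 2) ?nnegrE ?normr_ge0//.
rewrite real_normK ?num_real//.
apply: (@le_trans _ _ (sqn (z1 * conjc z2))).
  by rewrite /sqn lerDl sqr_ge0.
by rewrite sqnM sqnJ exprMn ler_pM ?sqn_ge0.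
Qed.

(** The positions z need not be distinct, so Parseval's identity leaves the
    diagonal z k = z l.  The bounds B on the moduli are there because the coefficients
    will be nonnegative weights divided by complex numbers bounded away from 0. *)
Lemma parseval_le (K : finType) (c : K -> R[i]) (B : K -> R) (z : K -> nat) :
  (forall k, 0 <= B k) -> (forall k, sqn (c k) <= B k ^+ 2) ->
  (forall k, z k < Q)%N ->
  \sum_(v < Q) sqn (\sum_k c k * chr (v%:R * (z k)%:R)) <=
  Q%:R * \sum_k \sum_(l | z k == z l) B k * B l.
Proof.
move=> B0 cB zQ; under eq_bigr do rewrite sqn_sum.
rewrite exchange_big mulr_sumr /= ler_sum// => k _.
rewrite exchange_big mulr_sumr /= [leRHS]big_mkcond/= ler_sum// => l _.
rewrite -Re_sum.
have -> : \sum_(v < Q) c k * chr (v%:R * (z k)%:R) *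
     conjc (c l * chr (v%:R * (z l)%:R)) = c k * conjc (c l) *
   (if z k == z l then Q%:R else 0).
  rewrite -chr_orthogonal// mulr_sumr; apply: eq_bigr => v _.
  by rewrite conjcM; ring.
case: ifP => _; last by rewrite mulr0.
rewrite -(rmorph_nat (real_complex R)) mulrC.
rewrite (_ : complex.Re _ = Q%:R * complex.Re (c k * conjc (c l))); last first.
  by case: (c k * _) => x y /=; rewrite mul0r subr0.
by rewrite ler_wpM2l// Re_mul_conj_le.
Qed.

(** The Dirichlet kernel of length n is of full size on frequencies below Q / (8 n). *)
Lemma dirichlet_ge (n : nat) (x : R) : `|x| * n%:R * 8 <= Q%:R ->
  (n%:R / 2) ^+ 2 <= sqn (\sum_(k < n) chr (x * k%:R)).
Proof.
move=> xn; set D := \sum_(k < n) _.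
have hD : n%:R / 2 <= complex.Re D.
  rewrite /D Re_sum -[n in n%:R / 2]card_ord -sum1_card natr_sum mulr_suml.
  apply: ler_sum => k _; rewrite div1r Re_chr_ge// normrM normr_nat.
  apply: le_trans xn; rewrite ler_wpM2r// ler_wpM2l// ler_nat ltnW//.
rewrite /sqn -[leLHS]addr0 lerD ?sqr_ge0// ler_pXn2r ?nnegrE ?divr_ge0//.
by rewrite (le_trans _ hD)// divr_ge0.
Qed.

Lemma sum_window (F : nat -> R) (a n N : nat) : (a + n <= N)%N ->
  \sum_(v < N | (a <= v < a + n)%N) F v = \sum_(u < n) F (a + u)%N.
Proof.
move=> anN; rewrite -(big_mkord xpredT (fun u => F (a + u)%N)).
transitivity (\sum_(a <= v < a + n) F v); last first.
  rewrite -{1}[a]add0n big_addn addKn; apply: eq_bigr => u _.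
  by rewrite addnC.
rewrite (big_nat_widen _ _ _ _ _ anN) (big_nat_widenl _ 0)// big_mkord.
by apply: eq_bigl => v; rewrite andbC andTb.
Qed.

(** Multiplying the exponential sum by the Dirichlet kernel of length m, which is at
    least m/2 on the frequencies v < W, amounts to smoothing the coefficients over
    windows of length m.  Parseval over the full group then only sees pairs of
    positions at distance less than m, hence the window bound S. *)
Lemma local_l2_le (J : finType) (b : J -> nat) (g : J -> R[i]) (B : J -> R)
    (m W : nat) (S : R) :
  (0 < m)%N -> (forall j, 0 <= B j) -> (forall j, sqn (g j) <= B j ^+ 2) ->
  (forall j, b j + m <= Q)%N -> (8 * m * W <= Q)%N ->
  (forall x, \sum_(j | (b j <= x < b j + m)%N) B j <= S) ->
  \sum_(v < Q | (v < W)%N) sqn (\sum_j g j * chr (v%:R * (b j)%:R)) <=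
  4 * Q%:R * S * (\sum_j B j) / m%:R.
Proof.
move=> m0 B0 gB bQ mW BS.
have mr0 : 0 < m%:R :> R by rewrite ltr0n.
pose G v := \sum_j g j * chr (v%:R * (b j)%:R).
pose D v := \sum_(y < m) chr (v%:R * y%:R).
have GD v : G v * D v = \sum_(k : J * 'I_m) g k.1 * chr (v%:R * (b k.1 + k.2)%:R).
  rewrite /G /D big_distrlr /= pair_big /=; apply: eq_bigr => -[j y] _ /=.
  by rewrite natrD mulrDr chrD mulrA.
apply: (@le_trans _ _ ((m%:R / 2) ^- 2 * \sum_(v < Q) sqn (G v * D v))).
  rewrite big_mkcond mulr_sumr /= ler_sum// => v _; case: ifP => vW; last first.
    by rewrite mulr_ge0 ?sqn_ge0// invr_ge0 sqr_ge0.
  rewrite sqnM mulrCA ler_peMr ?sqn_ge0//.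
  rewrite mulrC ler_pdivlMr ?exprn_gt0 ?divr_gt0// mul1r dirichlet_ge//.
  rewrite normr_nat -!natrM ler_nat (leq_trans _ mW)//.
  by move: vW; clear; nia.
have H : \sum_(v < Q) sqn (G v * D v) <= Q%:R * (m%:R * S * \sum_j B j).
  under eq_bigr do rewrite GD.
  apply: le_trans.
    apply: (parseval_le _ _ (fun k => B k.1)) => //= -[j y] /=.
    by rewrite (leq_trans _ (bQ j))// ltn_add2l.
  rewrite ler_wpM2l// -(pair_big xpredT xpredT (fun j (y : 'I_m) =>
     \sum_(l : J * 'I_m | (b j + y == b l.1 + l.2)%N) B j * B l.1)) /=.
  rewrite mulr_sumr ler_sum// => j _.
  rewrite -mulrA mulr_natl -[m in _ *+ m]card_ord -sumr_const ler_sum// => y _.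
  rewrite -mulr_sumr mulrC ler_wpM2r//; apply: le_trans (BS (b j + y)%N).
  rewrite -(pair_big_dep xpredT (fun i (z : 'I_m) => (b j + y == b i + z)%N)
    (fun i _ => B i)) /= [leRHS]big_mkcond /= ler_sum// => i _.
  case: ifP => [/andP[le1 le2]|nle].
    have lm : (b j + y - b i < m)%N by rewrite ltn_subLR.
    rewrite (big_pred1 (Ordinal lm))// => z; apply/eqP/eqP => [h|-> /=].
      by apply/val_inj => /=; rewrite h addKn.
    by rewrite subnKC.
  rewrite big_pred0// => z; apply/negP => /eqP h; move: nle.
  by rewrite h leq_addr ltn_add2l ltn_ord.
apply: (@le_trans _ _ ((m%:R / 2) ^- 2 * (Q%:R * (m%:R * S * \sum_j B j)))).
  by rewrite ler_wpM2l// invr_ge0 sqr_ge0.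
by rewrite le_eqVlt; apply/orP; left; apply/eqP; field; rewrite gt_eqF.
Qed.

(** An exponential sum supported on positions b j <= X is essentially constant on
    windows of q frequencies when q * X is small compared with Q.  Precisely,
    the average H j of the character over such a window has modulus at least 1/2, so
    the sum at t is the average over [t, t + q) of the sum G with coefficients
    beta j / H j.  By Jensen the left-hand side is at most the sum of |G v|^2 / q
    over v, each v counted with the mass of the frequencies t i in (v - q, v], which
    is at most M; what remains is the local L2 bound with window length m. *)
Theorem large_sieve (I J : finType) (t : I -> nat) (nu : I -> R)
    (b : J -> nat) (beta : J -> R) (q m X V : nat) (M S : R) :
  (0 < q)%N -> (0 < m)%N ->
  (forall i, 0 <= nu i) -> (forall j, 0 <= beta j) ->
  (forall i, t i <= V)%N -> (forall j, b j <= X)%N ->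
  (8 * q * X <= Q)%N -> (8 * m * (V + q) <= Q)%N ->
  (forall v, \sum_(i | (t i <= v < t i + q)%N) nu i <= M) ->
  (forall x, \sum_(j | (b j <= x < b j + m)%N) beta j <= S) ->
  \sum_i nu i * sqn (\sum_j (beta j)%:C * chr ((t i)%:R * (b j)%:R)) <=
  16 * Q%:R * M * S * (\sum_j beta j) / (q%:R * m%:R).
Proof.
move=> q0 m0 nu0 beta0 tV bX qX mV nuM betaS.
have qr0 : 0 < q%:R :> R by rewrite ltr0n.
pose H j : R[i] := (q%:R^-1)%:C * \sum_(u < q) chr ((b j)%:R * u%:R).
have H4 j : 4^-1 <= sqn (H j).
  rewrite sqnM sqn_real.
  have := @dirichlet_ge q (b j)%:R.
  rewrite normr_nat -!natrM ler_nat => /(_ _)/wrap[|h].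
    by have := bX j; move: qX; clear; nia.
  apply: (@le_trans _ _ (q%:R^-1 ^+ 2 * (q%:R / 2) ^+ 2)).
    by rewrite le_eqVlt; apply/orP; left; apply/eqP; field; rewrite gt_eqF.
  by rewrite ler_wpM2l ?sqr_ge0.
have Hn0 j : H j != 0.
  apply/eqP => H0; have := H4 j; rewrite H0 (sqn_real 0) expr0n /=; lra.
pose g j := (beta j)%:C / H j.
(* dividing by H j at most doubles the modulus of the coefficient *)
have gB j : sqn (g j) <= (2 * beta j) ^+ 2.
  have e : sqn (g j) * sqn (H j) = beta j ^+ 2.
    by rewrite -sqnM /g mulfVK// sqn_real.
  have := H4 j; have := sqn_ge0 (g j); rewrite exprMn; nra.
pose G v := \sum_j g j * chr (v%:R * (b j)%:R).
have fG i : \sum_j (beta j)%:C * chr ((t i)%:R * (b j)%:R) =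
    \sum_(u < q) (q%:R^-1)%:C * G (t i + u)%N.
  rewrite -mulr_sumr exchange_big /= mulr_sumr; apply: eq_bigr => j _.
  have -> : (beta j)%:C = g j * H j by rewrite /g mulfVK.
  rewrite -mulr_sumr; move: (g j) => gj; rewrite /H -!mulrA mulrCA.
  congr (_ * (_ * _)); rewrite mulr_suml; apply: eq_bigr => u _.
  by rewrite -chrD natrD mulrDl [_ * u%:R]mulrC addrC.
have step1 : \sum_i nu i * sqn (\sum_j (beta j)%:C * chr ((t i)%:R * (b j)%:R)) <=
    q%:R^-1 * \sum_i nu i * \sum_(v < Q | (t i <= v < t i + q)%N) sqn (G v).
  rewrite mulr_sumr ler_sum// => i _; rewrite mulrCA ler_wpM2l// fG.
  apply: le_trans.
    by apply: sqn_jensen => _; rewrite invr_ge0 ltW.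
  rewrite sumr_const card_ord -[_ *+ q]mulr_natl divff ?gt_eqF// mul1r.
  rewrite -mulr_sumr ler_wpM2l ?invr_ge0 ?ler0n//.
  have tq : (t i + q <= Q)%N.
    apply: leq_trans mV; apply: (@leq_trans (V + q)); first by rewrite leq_add2r.
    by rewrite leq_pmull// muln_gt0.
  by rewrite (sum_window (fun v => sqn (G v)) _ _ _ tq).
apply: (le_trans step1).
have M0 : 0 <= M by apply: le_trans (nuM 0); apply: sumr_ge0.
have step2 : \sum_i nu i * \sum_(v < Q | (t i <= v < t i + q)%N) sqn (G v) <=
    M * \sum_(v < Q | (v < V + q)%N) sqn (G v).
  under eq_bigr do rewrite mulr_sumr big_mkcond.
  rewrite exchange_big mulr_sumr [leRHS]big_mkcond /= ler_sum// => v _.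
  rewrite -big_mkcond -mulr_suml; case: ifP => vV.
    by rewrite ler_wpM2r// sqn_ge0.
  rewrite big_pred0 ?mul0r// => i; apply/negP => /andP[_ h].
  by move: vV; rewrite (leq_trans h)// leq_add2r.
apply: (@le_trans _ _ (q%:R^-1 * (M * (4 * Q%:R * (2 * S) *
    (\sum_j (2 * beta j)) / m%:R)))).
  rewrite ler_wpM2l ?invr_ge0 ?ler0n// (le_trans step2)// ler_wpM2l//.
  apply: local_l2_le => //.
  - by move=> j; rewrite mulr_ge0.
  - move=> j; have := bX j; move: q0 qX mV m0; nia.
  - by move=> x; rewrite -mulr_sumr ler_wpM2l.
rewrite -mulr_sumr le_eqVlt; apply/orP; left; apply/eqP; field.
by rewrite !gt_eqF// ltr0n.
Qed.

(** The squared modulus of the Dirichlet kernel of length n is nonnegative, is at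
    least (n/2)^2 at differences up to r, and is the sum of the characters of
    frequency k - l over k, l < n.  Summed over all pairs (i, j) it becomes a sum of
    squared moduli of transforms at the frequencies k - l, where each value of
    |k - l| occurs at most 2 n times. *)
Theorem close_pairs_le (I : finType) (w x : I -> R) (n : nat) (r : R) :
  (0 < n)%N -> (forall i, 0 <= w i) -> r * n%:R * 8 <= Q%:R ->
  \sum_i \sum_(j | `|x i - x j| <= r) w i * w j <=
  8 / n%:R * \sum_(k < n) sqn (\sum_i (w i)%:C * chr (k%:R * x i)).
Proof.
move=> n0 w0 rQ.
have nr0 : 0 < n%:R :> R by rewrite ltr0n.
pose F (y : R) := \sum_i (w i)%:C * chr (y * x i).
pose D y := \sum_(k < n) chr (y * k%:R).
have FN y : sqn (F (- y)) = sqn (F y).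
  rewrite -[RHS]sqnJ; congr sqn; rewrite conjc_sum; apply: eq_bigr => i _.
  by rewrite conjcM conjc_real mulNr chrN.
have key : \sum_i \sum_j w i * w j * sqn (D (x i - x j)) =
    \sum_(k < n) \sum_(l < n) sqn (F (k%:R - l%:R)).
  transitivity (\sum_i \sum_j \sum_(k < n) \sum_(l < n)
      w i * w j * complex.Re (chr ((x i - x j) * k%:R) * conjc (chr ((x i - x j) * l%:R)))).
    apply: eq_bigr => i _; apply: eq_bigr => j _; rewrite sqn_sum mulr_sumr.
    by apply: eq_bigr => k _; rewrite mulr_sumr.
  under eq_bigr do rewrite exchange_big.
  under eq_bigr do under eq_bigr do rewrite exchange_big.
  rewrite exchange_big; apply: eq_bigr => k _; rewrite exchange_big.
  apply: eq_bigr => l _; rewrite sqn_sum; apply: eq_bigr => i _; apply: eq_bigr => j _.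
  rewrite conjcM conjc_real -!chrN -chrD.
  rewrite mulrACA -chrD -rmorphM.
  rewrite (_ : (x i - x j) * k%:R - _ = (k%:R - l%:R) * x i - (k%:R - l%:R) * x j); last by ring.
  by case: (chr _) => a b /=; rewrite mul0r subr0.
have le1 : (n%:R / 2) ^+ 2 * \sum_i \sum_(j | `|x i - x j| <= r) w i * w j <=
    \sum_i \sum_j w i * w j * sqn (D (x i - x j)).
  rewrite mulr_sumr ler_sum// => i _; rewrite mulr_sumr big_mkcond /= ler_sum// => j _.
  case: ifP => h; last by rewrite !mulr_ge0 ?sqn_ge0.
  rewrite mulrC ler_wpM2l ?mulr_ge0// dirichlet_ge//.
  by apply: le_trans rQ; rewrite !ler_wpM2r.
have le2 : \sum_(k < n) \sum_(l < n) sqn (F (k%:R - l%:R)) <=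
    n%:R * (2 * \sum_(k < n) sqn (F k%:R)).
  rewrite mulr_natl -[n in _ *+ n]card_ord -sumr_const ler_sum// => k _.
  rewrite (bigID (fun l : 'I_n => (l <= k)%N)) /= mulr2n mulrDl mul1r lerD//.
    rewrite -(big_mkord (fun l => l <= k)%N (fun l => sqn (F (k%:R - l%:R)))).
    rewrite -(big_mkord xpredT (fun l => sqn (F l%:R))).
    rewrite (@big_cat_nat _ _ _ k.+1)//= [X in _ + X]big_nat_cond.
    rewrite [X in _ + X]big_pred0 ?addr0; last by move=> v; apply/negP; lia.
    rewrite big_nat_cond (eq_bigl (fun l => 0 <= l < k.+1)%N); last by move=> l; lia.
    rewrite -big_nat big_nat_rev /= add0n.
    rewrite [leRHS](@big_cat_nat _ _ _ k.+1)//= ler_wpDr ?sumr_ge0// => *; rewrite ?sqn_ge0//.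
    rewrite !big_nat ler_sum// => l lk.
    by rewrite -natrB ?subSS ?leq_subr// subKn.
  rewrite -(big_mkord (fun l => ~~ (l <= k))%N (fun l => sqn (F (k%:R - l%:R)))).
  rewrite -(big_mkord xpredT (fun l => sqn (F l%:R))).
  rewrite (@big_cat_nat _ _ _ k.+1)//= [X in X + _]big_nat_cond.
  rewrite [X in X + _]big_pred0 ?add0r; last by move=> v; apply/negP; lia.
  rewrite big_nat_cond (eq_bigl (fun l => k.+1 <= l < n)%N); last by move=> l; lia.
  rewrite -big_nat -{1}[k.+1]add0n big_addn.
  case: n n0 k {rQ nr0 D key le1} => // n _ k.
  rewrite [leRHS]big_nat_recl// subSS ler_wpDl ?sqn_ge0//.
  rewrite [leRHS](@big_cat_nat _ _ _ (n - k))//= ?leq_subr//.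
  rewrite ler_wpDr ?sumr_ge0// => *; rewrite ?sqn_ge0//.
  rewrite le_eqVlt; apply/orP; left; apply/eqP; apply: eq_bigr => l _.
  by rewrite -[RHS]FN; congr (sqn (F _)); rewrite natrD -natr1; ring.
rewrite key in le1; have := le_trans le1 le2.
set T := \sum_i _; set G := \sum_(k < n) _ => h.
have c0 : 0 < (n%:R / 2 : R) ^+ 2 by rewrite exprn_gt0 ?divr_gt0.
rewrite -(ler_pM2l c0); apply: (le_trans h).
by rewrite le_eqVlt; apply/orP; left; apply/eqP; field; rewrite gt_eqF.
Qed.

End FiniteFourier.
Arguments chr {R} Q x : simpl never.

(** * Weights on the dyadic tree *)

Section FrostmanTree.
Context {R : realType}.
Variables (A : set R) (x0 eta : R) (s : R) (T : nat).
Hypotheses (eta0 : 0 < eta).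
Implicit Types (w : nat -> R) (i j k d e : nat) (x : R).

Definition in_block k e x : bool :=
  ((k * 2 ^ e)%:R * eta <= x - x0 < (k.+1 * 2 ^ e)%:R * eta).

Definition block_cap e : R := ((2 ^ e)%:R * eta) `^ s.

(** The index j stands for the cell of length eta starting at x0 + j * eta, and the
    block (k, e) consists of the 2 ^ e cells with j %/ 2 ^ e = k. *)
Definition block_mass w k e : R := \sum_(j < T | (j %/ 2 ^ e)%N == k) w j.

Lemma block_cap_gt0 e : 0 < block_cap e.
Proof. by rewrite powR_gt0// mulr_gt0// ltr0n expn_gt0. Qed.

Lemma block_mass_ge0 w k e : (forall j, 0 <= w j) -> 0 <= block_mass w k e.
Proof. by move=> w0; apply: sumr_ge0. Qed.

Lemma block_mass_eq0 w i d k e : (e <= d)%N ->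
  (forall j, w j != 0 -> (j %/ 2 ^ d)%N = i) ->
  (k %/ 2 ^ (d - e))%N != i -> block_mass w k e = 0.
Proof.
move=> ed wi ki; apply: big1 => j /eqP jk; apply/eqP; apply: contraNT ki => /wi <-.
by rewrite -jk -divnMA -expnD subnKC.
Qed.

Lemma block_mass_le_total w k e : (forall j, 0 <= w j) -> block_mass w k e <= \sum_(j < T) w j.
Proof. by move=> w0; rewrite /block_mass big_mkcond ler_sum// => j _; case: ifP. Qed.

Lemma in_block_split k e x :
  in_block k e.+1 x = in_block (k.*2) e x || in_block (k.*2.+1) e x.
Proof.
rewrite /in_block -!(mulnC (2 ^ _)%N) !expnS -!mul2n.
rewrite [(2 ^ e * (2 * k))%N]mulnCA mulnA.
rewrite (_ : (2 ^ e * (2 * k).+2 = 2 * 2 ^ e * k.+1)%N); last by ring.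
set a := (_ * eta); set b := (_ * eta); set c := (_ * eta).
have ac : a <= c by rewrite (ler_wpM2r (ltW eta0))// ler_nat; nia.
have cb : c <= b by rewrite (ler_wpM2r (ltW eta0))// ler_nat; nia.
case: (leP a) => h1; case: (ltP _ b) => h2; case: (ltP _ c) => h3; rewrite ?andbF//=; lra.
Qed.

(** Max-flow / min-cut on the dyadic tree.  The weight of a block is built from
    those of its two halves; whenever the total exceeds the capacity of the
    block it is scaled down to that capacity, and the block itself replaces the
    covers of the halves.  So the capacities are respected at every level, while the
    total mass always dominates the cost of some cover of A by blocks.  Costs of
    covers are bounded below by the Hausdorff premeasure, which is what gives the
    mass a lower bound independent of the depth of the tree. *)
Lemma frostman_tree d i : (i.+1 * 2 ^ d <= T)%N ->
  exists (w : nat -> R) (cs : seq (nat * nat)),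
  [/\ forall j, 0 <= w j,
      forall j, w j != 0 -> (j %/ 2 ^ d)%N = i /\ exists2 x, A x & in_block j 0 x,
      forall k e, (e <= d)%N -> block_mass w k e <= block_cap e,
      forall x, A x -> in_block i d x -> exists2 c, c \in cs & in_block c.1 c.2 x &
      \sum_(c <- cs) block_cap c.2 <= \sum_(j < T) w j].
Proof.
elim: d i => [|d IHd] i iT.
  have [[x Ax xi]|nA] := pselect (exists2 x, A x & in_block i 0 x).
    have iltT : (i < T)%N by rewrite expn0 muln1 in iT.
    exists (fun j => if j == i then block_cap 0 else 0), [:: (i, 0%N)]; split => /=.
    - by move=> j; case: ifP => // _; rewrite ltW// block_cap_gt0.
    - by move=> j; case: (eqVneq j i) => [->|_]; [move=> _; rewrite divn1; split=> //; exists x|rewrite eqxx].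
    - move=> k [|//] _; rewrite /block_mass; under eq_bigl do rewrite expn0 divn1.
      rewrite -big_mkcondr; have [kT|Tk] := ltnP k T; last first.
        rewrite big_pred0 ?ltW ?block_cap_gt0// => j; apply/negP => /andP[/eqP jk _].
        by move: Tk; rewrite -jk leqNgt ltn_ord.
      apply: (@le_trans _ _ (\sum_(j < T | j == Ordinal kT) block_cap 0)); last by rewrite big_pred1_eq.
      rewrite big_mkcond [leRHS]big_mkcond ler_sum// => j _ /=.
      by rewrite -val_eqE /=; case: eqP => //=; case: eqP => // *; rewrite ?ltW ?block_cap_gt0.
    - by move=> y _ yi; exists (i, 0%N) => //; rewrite inE.
    - rewrite big_seq1 /= -big_mkcond /=.
      by rewrite (big_pred1 (Ordinal iltT))// => j; rewrite -val_eqE.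
  exists (fun=> 0), [::]; split => //=.
  - by move=> j; rewrite eqxx.
  - by move=> k e _; rewrite /block_mass big1// ltW// block_cap_gt0.
  - by move=> x Ax xi; case: nA; exists x.
  - by rewrite big_nil big1.
have [|w1 [cs1 [w10 w1s w1c c1 m1]]] := IHd i.*2.
  by apply: leq_trans iT; rewrite expnS; nia.
have [|w2 [cs2 [w20 w2s w2c c2 m2]]] := IHd i.*2.+1.
  by apply: leq_trans iT; rewrite expnS; nia.
pose w j := w1 j + w2 j.
have w0 j : 0 <= w j by rewrite addr_ge0.
have ws j : w j != 0 -> (j %/ 2 ^ d.+1)%N = i /\ exists2 x, A x & in_block j 0 x.
  move=> wj; have e2 m : (m %/ 2 ^ d.+1 = (m %/ 2 ^ d) %/ 2)%N by rewrite expnSr divnMA.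
  have [w1j|w1j] := eqVneq (w1 j) 0; last first.
    by have [jd ?] := w1s _ w1j; split=> //; rewrite e2 jd; lia.
  have [w2j|w2j] := eqVneq (w2 j) 0; last first.
    by have [jd ?] := w2s _ w2j; split=> //; rewrite e2 jd; lia.
  by move: wj; rewrite /w w1j w2j addr0 eqxx.
have wc k e : (e <= d)%N -> block_mass w k e <= block_cap e.
  move=> ed; have -> : block_mass w k e = block_mass w1 k e + block_mass w2 k e.
    by rewrite /block_mass -big_split.
  have [ki|ki] := eqVneq (k %/ 2 ^ (d - e))%N i.*2.
    rewrite (block_mass_eq0 w2 i.*2.+1 d) ?addr0 ?w1c// => [j /w2s[]//|].
    by rewrite ki; apply/eqP; lia.
  by rewrite (block_mass_eq0 w1 i.*2 d) ?add0r ?w2c// => j /w1s[].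
have [le_cap|cap_lt] := leP (\sum_(j < T) w j) (block_cap d.+1).
  exists w, (cs1 ++ cs2); split => //.
  - move=> k e; rewrite leq_eqVlt => /orP[/eqP ->|]; last by rewrite ltnS; apply: wc.
    exact: le_trans (block_mass_le_total _ _ _ w0) le_cap.
  - move=> x Ax; rewrite in_block_split => /orP[/(c1 _ Ax)|/(c2 _ Ax)] [c cc xc];
      by exists c => //; rewrite mem_cat cc ?orbT.
  - by rewrite big_cat big_split lerD.
set t := \sum_(j < T) w j in cap_lt.
have t0 : 0 < t := lt_trans (block_cap_gt0 _) cap_lt.
pose th := block_cap d.+1 / t.
have th0 : 0 <= th by rewrite divr_ge0// ltW// block_cap_gt0.
have th1 : th <= 1 by rewrite ler_pdivrMr// mul1r ltW.
have tht : \sum_(j < T) th * w j = block_cap d.+1.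
  by rewrite -mulr_sumr -/t /th divfK// gt_eqF.
exists (fun j => th * w j), [:: (i, d.+1)]; split => //.
- by move=> j; rewrite mulr_ge0.
- by move=> j; rewrite mulf_eq0 negb_or => /andP[_ /ws].
- move=> k e; rewrite leq_eqVlt => /orP[/eqP ->|]; last first.
    rewrite ltnS => ed; apply: le_trans (wc k e ed).
    by rewrite /block_mass -mulr_sumr ler_piMl// block_mass_ge0.
  by rewrite -tht block_mass_le_total// => j; rewrite mulr_ge0.
- by move=> x _ xi; exists (i, d.+1) => //; rewrite inE.
- by rewrite big_seq1 tht.
Qed.

End FrostmanTree.

(** * Hausdorff measure and dimension on the line *)

Section HausdorffFacts.
Context {R : realType}.
Implicit Types (A U : set R) (s delta rho : R).

Lemma diameter_le U rho : (forall x y, U x -> U y -> `|x - y| <= rho) ->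
  (diameter U <= rho%:E)%E.
Proof.
move=> Urho; apply: ge_ereal_sup => _ [x Ux [y Uy <-]].
by rewrite lee_fin Urho.
Qed.

Lemma diameter_ge U x y : U x -> U y -> ((`|x - y|)%:E <= diameter U)%E.
Proof. by move=> Ux Uy; apply: ereal_sup_ubound; exists x => //; exists y. Qed.

Lemma diameter_pow_ge0 s U : (0 <= diameter_pow s U)%E.
Proof. by rewrite /diameter_pow; case: ifP => // _; exact: poweR_ge0. Qed.

Lemma diameter_pow_le s U rho : 0 <= s -> 0 <= rho ->
  (diameter U <= rho%:E)%E -> (diameter_pow s U <= (rho `^ s)%:E)%E.
Proof.
move=> s0 rho0 Urho; rewrite /diameter_pow; case: ifPn => [_|/set0P[x Ux]].
  by rewrite lee_fin powR_ge0.
have U0 : (0 <= diameter U)%E by rewrite (le_trans _ (diameter_ge _ _ _ Ux Ux))// lee_fin.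
rewrite -poweR_EFin gt0_ler_poweR// in_itv/= leey andbT//.
Qed.

Lemma hausdorff_premeasure_ge0 s delta A : (0 <= hausdorff_premeasure s delta A)%E.
Proof.
apply: le_ereal_inf_tmp => _ [U _ <-]; apply: nneseries_ge0 => i _ _.
exact: diameter_pow_ge0.
Qed.

Lemma hausdorff_premeasure_le_cover (C : eqType) s delta A (cs : seq C) (U : C -> set R)
    (rho : C -> R) : 0 <= s -> 0 <= delta ->
  (forall c, 0 <= rho c) -> (forall c, c \in cs -> rho c <= delta) ->
  (forall c x y, U c x -> U c y -> `|x - y| <= rho c) ->
  (forall x, A x -> exists2 c, c \in cs & U c x) ->
  (hausdorff_premeasure s delta A <= (\sum_(c <- cs) rho c `^ s)%:E)%E.
Proof.
move=> s0 delta0 rho0 rhod Urho AU.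
pose V n := nth set0 (map U cs) n.
have VE n (nc : (n < size cs)%N) c0 : V n = U (nth c0 cs n).
  by rewrite /V (nth_map c0).
have V0 n : (size cs <= n)%N -> V n = set0.
  by move=> nc; rewrite /V nth_default// size_map.
have d0 : diameter (@set0 R) = -oo%E.
  rewrite /diameter (_ : [set _ | _ in _ & _ in _] = set0) ?ereal_sup0//.
  by rewrite -subset0 => x [].
apply: (@le_trans _ _ (\sum_(i <oo) diameter_pow s (V i))%E).
  apply: ereal_inf_lbound; exists V => //; split.
    move=> i; have [ic|ic] := ltnP i (size cs); last by rewrite V0// d0 leNye.
    case: cs rhod AU V VE V0 ic => // c0 cs rhod AU V VE V0 ic.
    rewrite (VE _ _ c0)//; apply: (@le_trans _ _ (rho (nth c0 (c0 :: cs) i))%:E).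
      by apply: diameter_le => x y; apply: Urho.
    by rewrite lee_fin rhod// mem_nth.
  move=> x /AU[c cc Ux]; exists (index c cs) => //.
  by rewrite (VE _ _ c) ?index_mem// nth_index.
rewrite (nneseries_split _ (size cs)); last by move=> k _; exact: diameter_pow_ge0.
rewrite [X in (_ + X)%E]eseries0 ?adde0; last first.
  by move=> i ic _; rewrite V0// /diameter_pow eqxx.
rewrite -sumEFin; case: cs rhod AU V VE V0 => [|c0 cs] rhod AU V VE V0.
  by rewrite !big_nil.
rewrite add0n (big_nth c0) !big_mkord; apply: lee_sum => i _.
rewrite (VE _ (ltn_ord i) c0); apply: diameter_pow_le => //.
by apply: diameter_le => x y; apply: Urho.
Qed.

(** Blocks of all sizes up to the whole interval [-2^l, 2^l) are allowed in the
    covers produced by [frostman_tree].  A cover by blocks no longer than delta costs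
    at least the premeasure at scale delta, and any other cover contains a block that
    alone costs delta^s; hence h, which does not depend on N, is the minimum of the
    two.  With lam = 2^-s, a block of 2^e cells of length 2^-N has capacity
    lam^(N - e). *)
Lemma discrete_frostman A s (l : nat) : 0 <= s ->
  hausdorff_measure s A != 0%E ->
  (forall x, A x -> `|x| < (2 ^ l)%:R) ->
  exists2 h : R, 0 < h & forall N : nat, exists w : nat -> R,
    [/\ forall j, 0 <= w j,
        forall j, w j != 0 -> exists2 x, A x &
          j%:R / (2 ^ N)%:R <= x + (2 ^ l)%:R < j.+1%:R / (2 ^ N)%:R,
        forall k e, (e <= N)%N ->
          block_mass (2 ^ (l.+1 + N)) w k e <= (2 `^ (- s)) ^+ (N - e),
        h <= \sum_(j < 2 ^ (l.+1 + N)) w j &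
        \sum_(j < 2 ^ (l.+1 + N)) w j <= (2 ^ l.+1)%:R `^ s].
Proof.
move=> s0 HA Al.
have [delta delta0 [h0 h00 hA]] : exists2 delta : R, 0 < delta &
    exists2 h0 : R, 0 < h0 & (h0%:E <= hausdorff_premeasure s delta A)%E.
  have H0 : (0 < hausdorff_measure s A)%E.
    rewrite lt_def HA; apply: le_ereal_sup_tmp.
    exists (hausdorff_premeasure s 1 A); last exact: hausdorff_premeasure_ge0.
    by exists 1 => //=; exact: ltr01.
  have [_ [delta /= delta0 <-]] := ereal_sup_gt H0.
  case E: (hausdorff_premeasure s delta A) => [r| |] //.
    by rewrite lte_fin => r0; exists delta => //; exists r => //; rewrite E.
  by move=> _; exists delta => //; exists 1 => //; rewrite E leey.
exists (Num.min h0 (delta `^ s)); first by rewrite lt_min h00 powR_gt0.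
move=> N; set T := (2 ^ (l.+1 + N))%N.
have q0 : 0 < (2 ^ N)%:R :> R by rewrite ltr0n expn_gt0.
have eta0 : 0 < (2 ^ N)%:R^-1 :> R by rewrite invr_gt0.
have [|w [cs [w0 wsupp wcap cover cov_le]]] :=
  @frostman_tree R A (- (2 ^ l)%:R) (2 ^ N)%:R^-1 s T eta0 (l.+1 + N) 0.
  by rewrite mul1n.
exists w; split => //.
- by move=> j /wsupp[_ [x Ax]]; rewrite /in_block opprK expn0 !muln1 => xj; exists x.
- move=> k e eN; apply: (le_trans (wcap k e _)); first by rewrite (leq_trans eN) ?leq_addl.
  rewrite le_eqVlt; apply/orP; left; apply/eqP; rewrite /block_cap.
  rewrite -powR_mulrn ?powR_ge0// -!powRrM.
  rewrite (_ : (2 ^ e)%:R / (2 ^ N)%:R = 2 `^ (- (N - e)%:R)); last first.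
    rewrite powR_invn// -{1}(subnK eN) addnC expnD natrM invfM mulrA.
    by rewrite divff ?mul1r ?natrX// pnatr_eq0 expn_eq0.
  by rewrite -powRrM !mulNr mulrC.
- have [/hasP[c cc dc]|/hasPn nc] := boolP (has (fun c => delta < (2 ^ c.2)%:R / (2 ^ N)%:R) cs).
    rewrite ge_min; apply/orP; right; apply: (le_trans _ cov_le).
    rewrite (big_rem c)//= ler_wpDr ?sumr_ge0// => *; first by rewrite ltW// block_cap_gt0.
    by rewrite /block_cap ge0_ler_powR ?nnegrE// ?divr_ge0// ltW.
  rewrite ge_min; apply/orP; left; apply: (le_trans _ cov_le).
  rewrite -lee_fin (le_trans hA)//.
  apply: (@hausdorff_premeasure_le_cover _ _ _ _ _
    (fun c => [set x | in_block (- (2 ^ l)%:R) (2 ^ N)%:R^-1 c.1 c.2 x])) => //.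
  + exact: ltW.
  + by move=> c /nc; rewrite -leNgt.
  + move=> [k e] x y /= /andP[x1 x2] /andP[y1 y2].
    rewrite mulSn natrD mulrDl in x2 y2; rewrite ler_norml; lra.
  + move=> x Ax; apply: cover => //; rewrite /in_block mul0n mul0r mul1n.
    rewrite expnD natrM mulfK ?gt_eqF// expnS mulSn mul1n natrD opprK.
    by have := Al x Ax; rewrite ltr_norml; lra.
- have := wcap 0%N (l.+1 + N)%N (leqnn _).
  rewrite /block_cap expnD natrM mulfK ?gt_eqF//; apply: le_trans.
  rewrite /block_mass [leRHS]big_mkcond /=; apply: ler_sum => j _.
  by rewrite divn_small.
Qed.

Lemma hausdorff_dim_ge0 A : (0 <= hausdorff_dim A)%E.
Proof. by apply: le_ereal_inf_tmp => _ [s [s0 _] <-]; rewrite lee_fin. Qed.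

Lemma hausdorff_measure_ge0 s A : (0 <= hausdorff_measure s A)%E.
Proof.
apply: le_ereal_sup_tmp; exists (hausdorff_premeasure s 1 A); last exact: hausdorff_premeasure_ge0.
by exists 1 => //=; exact: ltr01.
Qed.

Lemma hausdorff_measure_eq0 s A :
  (forall delta eps : R, 0 < delta -> 0 < eps ->
    (hausdorff_premeasure s delta A <= eps%:E)%E) ->
  hausdorff_measure s A = 0%E.
Proof.
move=> H; apply/eqP; rewrite eq_le hausdorff_measure_ge0 andbT; apply: ge_ereal_sup.
move=> _ [delta /= delta0 <-]; apply/lee_addgt0Pr => eps eps0.
by rewrite add0e H.
Qed.

Lemma hausdorff_dim_le s A : 0 <= s -> hausdorff_measure s A = 0%E ->
  (hausdorff_dim A <= s%:E)%E.
Proof. by move=> s0 H; apply: ereal_inf_lbound; exists s. Qed.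

Lemma hausdorff_measure_neq0 s A : 0 <= s -> (s%:E < hausdorff_dim A)%E ->
  hausdorff_measure s A != 0%E.
Proof.
move=> s0; apply: contraPneq => H; apply/negP; rewrite -leNgt.
exact: hausdorff_dim_le.
Qed.

Lemma expr_lt_eps (z e : R) : 0 <= z -> z < 1 -> 0 < e ->
  exists n : nat, forall m, (n <= m)%N -> z ^+ m < e.
Proof.
move=> z0 z1 e0; have zc : z ^+ n @[n --> \oo] --> (0 : R).
  by apply: cvg_expr; rewrite ger0_norm.
have [n _ Hn] := cvgr0_norm_lt _ zc _ e0.
by exists n => m nm; have := Hn m nm; rewrite /= ger0_norm// exprn_ge0.
Qed.

(** Covering by all the cells of length 2^-N costs O(2^(N (1 - s))). *)
Lemma hausdorff_measure_bounded_eq0 A (l : nat) s : 1 < s ->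
  (forall x, A x -> `|x| < (2 ^ l)%:R) -> hausdorff_measure s A = 0%E.
Proof.
move=> s1 Al; apply: hausdorff_measure_eq0 => delta eps delta0 eps0.
have s0 : 0 < s by lra.
pose z : R := 2 `^ (1 - s).
have z0 : 0 <= z by exact: powR_ge0.
have z1 : z < 1.
  have ln2 : 0 < ln 2 :> R by rewrite ln_gt0// ltr1n.
  by rewrite /z /powR pnatr_eq0 /= expR_lt1; nra.
have L0 : 0 < (2 ^ l.+1)%:R :> R by rewrite ltr0n expn_gt0.
have [n1 Hn1] := expr_lt_eps _ _ z0 z1 (divr_gt0 eps0 L0).
have h0 : 0 <= (2^-1 : R) by [].
have h1 : (2^-1 : R) < 1 by lra.
have [n2 Hn2] := expr_lt_eps _ _ h0 h1 delta0.
pose N := maxn n1 n2.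
have q0 : 0 < (2 ^ N)%:R :> R by rewrite ltr0n expn_gt0.
apply: le_trans.
  apply: (@hausdorff_premeasure_le_cover _ _ _ _ (iota 0 (2 ^ (l.+1 + N)))
    (fun c => [set x | in_block (- (2 ^ l)%:R) (2 ^ N)%:R^-1 c 0 x])
    (fun=> (2 ^ N)%:R^-1)) => //.
  - exact: ltW.
  - exact: ltW.
  - by move=> _ _; rewrite natrX -exprVn ltW// Hn2// leq_maxr.
  - move=> k x y /= /andP[x1 x2] /andP[y1 y2].
    rewrite expn0 !muln1 -natr1 mulrDl mul1r in x1 x2 y1 y2; rewrite ler_norml; lra.
  - move=> x Ax; have := Al x Ax; rewrite ltr_norml => /andP[x1 x2].
    pose y := (x + (2 ^ l)%:R) * (2 ^ N)%:R.
    have y0 : 0 <= y by rewrite mulr_ge0// ltW//; lra.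
    have /andP[t1 t2] := truncn_itv y0.
    exists (Num.truncn y).
      rewrite mem_iota add0n /= -(ltr_nat R) (le_lt_trans t1)//.
      by rewrite expnD natrM ltr_pM2r// expnS mulSn mul1n natrD ltrD2r.
    rewrite /= /in_block expn0 !muln1 opprK ler_pdivrMr// ltr_pdivlMr//.
    by apply/andP.
rewrite lee_fin big_const_seq count_predT size_iota iter_addr_0.
rewrite -[leLHS]mulr_natl expnD natrM -mulrA.
rewrite (_ : (2 ^ N)%:R * _ = z ^+ N).
  by rewrite mulrC -ler_pdivlMr// ltW// Hn1// leq_maxl.
rewrite /z -[RHS]powR_mulrn ?powR_ge0// -powRrM natrX -powR_invn// -[X in X * _]powR_mulrn//.
rewrite -powRrM -powRD; last by rewrite pnatr_eq0 implybT.
by congr (_ `^ _); ring.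
Qed.

Lemma hausdorff_dim_le1 A (l : nat) :
  (forall x, A x -> `|x| < (2 ^ l)%:R) -> (hausdorff_dim A <= 1%:E)%E.
Proof.
move=> Al; apply/lee_addgt0Pr => eps eps0; rewrite -EFinD.
apply: hausdorff_dim_le; first lra.
by apply: hausdorff_measure_bounded_eq0 Al; rewrite ltrDl.
Qed.

Lemma hausdorff_dim_point (x : R) : hausdorff_dim [set x] = 0%E.
Proof.
apply/eqP; rewrite eq_le hausdorff_dim_ge0 andbT; apply/lee_addgt0Pr => s s0.
rewrite add0e; apply: hausdorff_dim_le; first exact: ltW.
apply: hausdorff_measure_eq0 => delta eps delta0 eps0.
apply: le_trans.
  apply: (@hausdorff_premeasure_le_cover _ _ _ _ [:: tt] (fun=> [set x]) (fun=> 0)) => //.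
  - exact: ltW.
  - exact: ltW.
  - by move=> _ _; exact: ltW.
  - by move=> _ y z -> ->; rewrite subrr normr0.
  - by move=> y Ay; exists tt => //; rewrite inE.
by rewrite lee_fin big_seq1 powR0 ?gt_eqF// ltW.
Qed.

(** A set of diameter d <= 1 lies in an interval of length 2 d <= 2 d^s, so the cost
    of a cover is at least half the Lebesgue measure of [0, 1]. *)
Lemma hausdorff_premeasure_unit_interval_ge s : 0 <= s -> s <= 1 ->
  ((2^-1)%:E <= hausdorff_premeasure s 1 (`[0%R, 1%R] : set R))%E.
Proof.
move=> s0 s1; apply: le_ereal_inf_tmp => _ [U [Ud AU] <-].
pose c i : R := get (U i).
pose d i : R := fine (diameter (U i)).
pose V i : set R := if U i == set0 then set0 else `[c i - d i, c i + d i]%classic.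
have Vm i : measurable (V i) by rewrite /V; case: ifP.
have VU i : (lebesgue_measure (V i) <= 2%:E * diameter_pow s (U i))%E.
  rewrite /V /diameter_pow; case: ifPn => [_|/set0P[x Ux]].
    by rewrite measure0 mule0.
  have U0 : (0 <= diameter (U i))%E.
    by rewrite (le_trans _ (diameter_ge _ _ _ Ux Ux))// lee_fin.
  have Ufin : diameter (U i) \is a fin_num.
    by rewrite ge0_fin_numE// (le_lt_trans (Ud i))// ltry.
  have d0 : 0 <= d i by rewrite fine_ge0.
  have d1 : d i <= 1 by rewrite -lee_fin fineK.
  rewrite -(fineK Ufin) -/(d i) poweR_EFin -EFinM.
  rewrite lebesgue_measure_itv /= lte_fin; case: ifP => _; last first.
    by rewrite lee_fin mulr_ge0// powR_ge0.
  rewrite -EFinD lee_fin opprD opprK addrACA subrr add0r -mulr2n -[leLHS]mulr_natl.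
  rewrite ler_wpM2l//; move: d0; rewrite le_eqVlt => /orP[/eqP <-|d0].
    exact: powR_ge0.
  by rewrite ger1_powR// d0.
have UV i : U i `<=` V i.
  move=> x Ux; have Un0 : U i !=set0 by exists x.
  rewrite /V ifF; last by apply/negbTE/set0P.
  have Uc : U i (c i) by apply: getPex.
  have Ufin : diameter (U i) \is a fin_num.
    rewrite ge0_fin_numE ?(le_lt_trans (Ud i)) ?ltry//.
    by rewrite (le_trans _ (diameter_ge _ _ _ Ux Ux))// lee_fin.
  have := diameter_ge _ _ _ Ux Uc; rewrite -(fineK Ufin) -/(d i) lee_fin ler_norml.
  by rewrite /= in_itv /=; lra.
have : (lebesgue_measure (`[0%R, 1%R] : set R) <= \sum_(i <oo) lebesgue_measure (V i))%E.
  apply: measure_sigma_subadditive => //.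
  by apply: (subset_trans AU); apply: subset_bigcup => i _; exact: UV.
rewrite lebesgue_measure_itv /= lte_fin ltr01 sube0 => h.
have {h}/le_trans : (1 <= \sum_(i <oo) 2%:E * diameter_pow s (U i))%E.
  by apply: (le_trans h); apply: lee_nneseries => // i _; exact: VU.
move=> /(_ (2%:E * \sum_(i <oo) diameter_pow s (U i))%E).
rewrite nneseriesZl//; last by move=> i _; exact: diameter_pow_ge0.
move=> /(_ (lexx _)).
by rewrite -lee_pdivrMl// mule1.
Qed.

Lemma hausdorff_dim_unit_interval : hausdorff_dim (`[0%R, 1%R] : set R) = 1%:E.
Proof.
apply/eqP; rewrite eq_le; apply/andP; split.
  apply: (@hausdorff_dim_le1 _ 1%N) => x; rewrite /= in_itv /= => /andP[x0 x1].
  by rewrite ger0_norm// (le_lt_trans x1)// ltr1n.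
apply: le_ereal_inf_tmp => _ [s [s0 Hs] <-]; rewrite lee_fin leNgt; apply/negP => s1.
have : ((2^-1)%:E <= hausdorff_measure s (`[0%R, 1%R] : set R))%E.
  apply: le_ereal_sup_tmp; exists (hausdorff_premeasure s 1 (`[0%R, 1%R] : set R)).
    by exists 1 => //=; exact: ltr01.
  by apply: hausdorff_premeasure_unit_interval_ge => //; exact: ltW.
by rewrite Hs lee_fin leNgt invr_gt0 ltr0n.
Qed.

End HausdorffFacts.

(** * Energy of the image of a product measure *)

Section Windows.
Context {R : realType}.
Implicit Types (w : nat -> R).

(** A window of length 2 ^ e, aligned or not, meets at most two dyadic blocks of that
    length. *)
Lemma window_mass_le w T e a (B : R) : (forall j, 0 <= w j) ->
  (forall k, block_mass T w k e <= B) ->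
  \sum_(j < T | (a <= j < a + 2 ^ e)%N) w j <= B + B.
Proof.
move=> w0 wB; apply: (@le_trans _ _ (block_mass T w (a %/ 2 ^ e) e + block_mass T w (a %/ 2 ^ e).+1 e)).
  rewrite /block_mass [leLHS]big_mkcond [X in X + _]big_mkcond [X in _ + X]big_mkcond /=.
  rewrite -big_split ler_sum// => j _ /=.
  have p0 : (0 < 2 ^ e)%N by rewrite expn_gt0.
  case: ifP => [/andP[aj ja]|_]; last by rewrite addr_ge0//; case: ifP.
  case: eqP => [_|n1]; first by rewrite lerDl; case: ifP.
  rewrite ifT ?add0r//; apply/eqP.
  have h1 : (a %/ 2 ^ e <= j %/ 2 ^ e)%N by rewrite leq_div2r.
  have h2 : (j %/ 2 ^ e <= (a %/ 2 ^ e).+1)%N.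
    rewrite -ltnS ltn_divLR//; apply: (leq_trans ja).
    by have := ltn_ceil a p0; rewrite !mulSn; lia.
  lia.
by rewrite lerD.
Qed.

Lemma count_window_le (n a p : nat) :
  \sum_(i < n | (a <= i < a + p)%N) (1 : R) <= p%:R.
Proof.
rewrite sumr_const ler_nat.
suff : (#|[pred i : 'I_n | (a <= i < a + p)%N]| <= #|'I_p|)%N by rewrite card_ord.
have [p0|p0] := posnP p.
  by rewrite eq_card0// => i; rewrite !inE; apply/negP; lia.
have lt i : ((i - a) %% p < p)%N by rewrite ltn_mod.
apply: (@leq_card_in _ _ (fun i : 'I_n => Ordinal (lt i))).
move=> i j; rewrite !inE => /andP[i1 i2] /andP[j1 j2] [].
rewrite !modn_small ?ltn_subLR// => h; apply/val_inj => /=; lia.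
Qed.

Lemma dyadic_blocks_sum (G : nat -> R) N :
  \sum_(k < 2 ^ N) G k = G 0%N + \sum_(j < N) \sum_(i < 2 ^ j) G (2 ^ j + i)%N.
Proof.
elim: N => [|N IHN]; first by rewrite expn0 big_ord1 big_ord0 addr0.
rewrite big_ord_recr /= addrA -IHN expnS mul2n -addnn big_split_ord /=.
by congr (_ + _); apply: eq_bigr => i _.
Qed.

Lemma geometric_sum_le (z : R) N : 0 <= z -> z < 1 ->
  \sum_(j < N) z ^+ j <= (1 - z)^-1.
Proof.
move=> z0 z1; have p : 0 < 1 - z by rewrite subr_gt0.
rewrite -[leRHS]mul1r ler_pdivlMr// mulrC.
have := subrX1 z N; have : 0 <= z ^+ N by rewrite exprn_ge0.
rewrite -[1 - z]opprB mulNr => h <-; rewrite opprB; lra.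
Qed.

End Windows.

(** In this section the unit of length is 1/q, so that A, B, C live on integers of
    absolute value at most half = 2^l q; the cell j has position j - half.  Products
    of two positions are integers in the unit 1/q^2, and frequencies k < q in the
    original unit are integers as well.  The order Q = 32 q T of the cyclic group
    makes the phases t b / Q, with b < T and t < q, at most 1/32 of a turn; this
    provides the size conditions of [large_sieve] and [close_pairs_le]. *)
Section Energy.
Local Open Scope complex_scope.
Context {R : realType}.
Variables (l N m0 : nat) (W lamA lamB lamC : R) (wA wB wC : nat -> R).

Let q := (2 ^ N)%N.
Let half := (2 ^ (l + N))%N.
Let T := (2 ^ (l.+1 + N))%N.
Let Q := (32 * q * T)%N.

Definition grid_pos l N (j : nat) : R := j%:R - (2 ^ (l + N))%:R.

Local Notation pos := (grid_pos l N).

Definition grid_abs l N (j : nat) : nat := (j - 2 ^ (l + N) + (2 ^ (l + N) - j))%N.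

Local Notation dist := (grid_abs l N).

Hypotheses (wA0 : forall j, 0 <= wA j) (wB0 : forall j, 0 <= wB j)
  (wC0 : forall j, 0 <= wC j).
Hypotheses (lamA0 : 0 <= lamA) (lamB0 : 0 <= lamB) (lamC0 : 0 <= lamC).
Hypotheses
  (massA : forall k e, (e <= N)%N -> block_mass T wA k e <= lamA ^+ (N - e))
  (massB : forall k e, (e <= N)%N -> block_mass T wB k e <= lamB ^+ (N - e))
  (massC : forall k e, (e <= N)%N -> block_mass T wC k e <= lamC ^+ (N - e)).
Hypotheses (totA : \sum_(j < T) wA j <= W) (totB : \sum_(j < T) wB j <= W)
  (totC : \sum_(j < T) wC j <= W).
Hypothesis (m0N : (m0 <= N)%N).
Hypothesis (awayA : forall j, wA j != 0 -> (2 ^ (N - m0) <= dist j)%N).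
Hypothesis (rho1 : 4 * (lamA * lamB * lamC) < 1).

Let q0 : (0 < q)%N. Proof. by rewrite expn_gt0. Qed.
Let TE : T = (2 * half)%N. Proof. by rewrite /T addSn expnS. Qed.
Let Q0 : (0 < Q)%N. Proof. by rewrite !muln_gt0 q0 expn_gt0. Qed.
Let W0 : 0 <= W. Proof. by apply: le_trans totA; apply: sumr_ge0. Qed.

Definition exp_sum (w : nat -> R) (y : R) : R[i] :=
  \sum_(j < T) (w j)%:C * chr Q (y * j%:R).

Lemma sqn_exp_sumN w y : sqn (exp_sum w (- y)) = sqn (exp_sum w y).
Proof.
rewrite -[RHS]sqnJ; congr sqn; rewrite conjc_sum; apply: eq_bigr => j _.
by rewrite conjcM conjc_real mulNr chrN.
Qed.

Lemma pos_abs j : pos j = (dist j)%:R \/ pos j = - (dist j)%:R.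
Proof.
rewrite /grid_pos /grid_abs; have [h|h] := leqP (2 ^ (l + N)) j.
  by left; rewrite natrD natrB// (eqP h) addr0.
by right; rewrite natrD (eqP (ltnW h)) add0r natrB ?(ltnW h)// opprB.
Qed.

(** Translating the positions multiplies an exponential sum by a unimodular factor,
    and changing the sign of the frequency conjugates it.  This turns the signed
    positions into natural numbers, as [large_sieve] requires. *)
Lemma sqn_exp_sum_pos (w : nat -> R) (k a : nat) :
  sqn (\sum_(j < T) (w j)%:C * chr Q (k%:R * pos a * pos j)) =
  sqn (exp_sum w (dist a * k)%N%:R).
Proof.
set y := k%:R * pos a.
have -> : \sum_(j < T) (w j)%:C * chr Q (y * pos j) =
    chr Q (- (y * half%:R)) * exp_sum w y.
  rewrite mulr_sumr; apply: eq_bigr => j _.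
  by rewrite /grid_pos mulrBr addrC chrD; ring.
rewrite sqnM sqn_chr mul1r /y natrM mulrC.
by case: (pos_abs a) => ->; rewrite ?mulNr ?sqn_exp_sumN.
Qed.

(** For k >= 2^j the frequencies |a| k in a window of length q come from an interval
    of at most 2^(N-j) values of |a|, that is, from two such intervals of values of a,
    each of which meets two dyadic blocks. *)
Lemma abs_window_mass_le (j k v : nat) : (j <= N)%N -> (2 ^ j <= k)%N ->
  \sum_(i < T | (dist i * k <= v < dist i * k + q)%N) wA i <= 4 * lamA ^+ j.
Proof.
move=> jN jk; have k0 : (0 < k)%N by rewrite (leq_trans _ jk)// expn_gt0.
pose m := (2 ^ (N - j))%N; pose c := (v %/ k)%N.
have qmk : (q <= m * k)%N by rewrite /q -(subnK jN) expnD leq_mul2l jk orbT.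
have win b : \sum_(i < T | (b <= i < b + m)%N) wA i <= lamA ^+ j + lamA ^+ j.
  apply: window_mass_le => // k'; have := massA k' (N - j)%N.
  by rewrite subKn ?leq_subr//; apply.
apply: (@le_trans _ _ (\sum_(i < T | (half + c.+1 - m <= i < half + c.+1 - m + m)%N) wA i +
   \sum_(i < T | (half - c <= i < half - c + m)%N) wA i)); last first.
  by rewrite (le_trans (lerD (win _) (win _)))//; lra.
rewrite [leLHS]big_mkcond [X in X + _]big_mkcond [X in _ + X]big_mkcond /=.
rewrite -big_split ler_sum// => i _ /=.
case: ifP => [/andP[h1 h2]|_]; last by rewrite addr_ge0//; case: ifP.
have u1 : (dist i <= c)%N by rewrite leq_divRL.
have u2 : (c < dist i + m)%N.
  by rewrite ltn_divLR// mulnDl (leq_trans h2)// leq_add2l.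
move: u1 u2; rewrite /grid_abs -/half; move: (half) => H.
have [hi|hi] := leqP H i => u1 u2.
  by rewrite ifT; [rewrite lerDl; case: ifP|clear -hi u1 u2; lia].
by rewrite [X in _ <= _ + X]ifT; [rewrite lerDr; case: ifP|clear -hi u1 u2; lia].
Qed.

Lemma window_le (w : nat -> R) (lam : R) (j x : nat) : (j <= N)%N ->
  (forall i, 0 <= w i) ->
  (forall k e, (e <= N)%N -> block_mass T w k e <= lam ^+ (N - e)) ->
  \sum_(i < T | (i <= x < i + 2 ^ (N - j))%N) w i <= 2 * lam ^+ j.
Proof.
move=> jN w0 wm; set m := (2 ^ _)%N.
apply: (@le_trans _ _ (\sum_(i < T | (x.+1 - m <= i < x.+1 - m + m)%N) w i)).
  rewrite [leLHS]big_mkcond [leRHS]big_mkcond /= ler_sum// => i _.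
  by case: ifP => [h|_]; [rewrite ifT//; clear -h; lia|case: ifP].
rewrite mulr_natl mulr2n; apply: window_mass_le => // k.
by have := wm k (N - j)%N; rewrite subKn ?leq_subr//; apply.
Qed.

(** The constant of [large_sieve] at the window length 2^(N-j) that is dual to
    frequencies of size 2^j. *)
Let sieve_const j M S B : (j <= N)%N ->
  16 * Q%:R * M * S * B / (q%:R * (2 ^ (N - j))%:R) =
  2 ^+ 9 * 2 ^+ l.+1 * M * S * 2 ^+ j * B :> R.
Proof.
move=> jN; have qE : q%:R = (2 ^ (N - j))%:R * 2 ^+ j :> R by rewrite -natrX -natrM -expnD subnK.
have QE : Q%:R = 32 * q%:R * (2 ^+ l.+1 * q%:R) :> R.
  by rewrite /Q /T expnD !natrM natrX.
rewrite QE qE; have : (2 ^ (N - j))%:R != 0 :> R by rewrite pnatr_eq0 expn_eq0.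
have : 2 ^+ j != 0 :> R by rewrite expf_neq0// pnatr_eq0.
move: (2 ^+ j) ((2 ^ (N - j))%:R) (2 ^+ l.+1) => x y z x0 y0.
by field; rewrite y0 x0.
Qed.

Let sizes j : (j < N)%N ->
  (8 * 2 ^ (N - j) * (T * 2 ^ j + q) <= Q)%N.
Proof.
move=> jN; have e1 : (2 ^ (N - j) * 2 ^ j = q)%N by rewrite -expnD subnK// ltnW.
have e2 : (2 ^ (N - j) <= q)%N by rewrite leq_exp2l// leq_subr.
have e3 : (q <= T)%N by rewrite leq_exp2l// leq_addl.
rewrite /Q; move: e1 e2 e3.
by move: (2 ^ (N - j))%N (2 ^ j)%N (T) (q) => a b t c; clear; nia.
Qed.

Let dist_le (i : 'I_T) : (dist i <= half)%N.
Proof.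
have : (i < 2 * half)%N by rewrite -TE.
by rewrite /grid_abs -/half; move: (half) => h; clear; lia.
Qed.

Let TE2 j : (T * 2 ^ j = half * 2 ^ j.+1)%N.
Proof. by rewrite TE expnS mulnCA mulnA. Qed.

(** Large sieve with the frequencies |a| k weighted by alpha, for one fixed k of
    size 2^j. *)
Lemma averaged_exp_sum_le j k : (j < N)%N -> (2 ^ j <= k < 2 ^ j.+1)%N ->
  \sum_(i < T) wA i * sqn (exp_sum wB (dist i * k)%N%:R) <=
  2 ^+ 12 * 2 ^+ l.+1 * W * (2 * (lamA * lamB)) ^+ j.
Proof.
move=> jN /andP[k1 k2]; have jN' := ltnW jN.
apply: le_trans.
  apply: (@large_sieve R Q Q0 _ _ (fun i : 'I_T => dist i * k)%N (fun i => wA i)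
    (fun i : 'I_T => nat_of_ord i) (fun i => wB i) q (2 ^ (N - j)) T (T * 2 ^ j)
    (4 * lamA ^+ j) (2 * lamB ^+ j)) => //.
  - by rewrite expn_gt0.
  - by move=> i; rewrite TE2 leq_mul ?dist_le// ltnW.
  - by move=> i; rewrite ltnW.
  - by rewrite /Q leq_mul// leq_mul.
  - exact: sizes.
  - by move=> v; apply: abs_window_mass_le.
  - by move=> x; apply: window_le.
rewrite sieve_const//; pose K := 2 ^+ 12 * 2 ^+ l.+1 * (2 * (lamA * lamB)) ^+ j.
have K0 : 0 <= K by rewrite !mulr_ge0// ?exprn_ge0// ?mulr_ge0.
rewrite [leRHS](_ : _ = K * W); last by rewrite /K; ring.
rewrite [leLHS](_ : _ = K * \sum_(i < T) wB i) ?ler_wpM2l//.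
by rewrite /K !exprMn; ring.
Qed.

(** Large sieve with the frequencies |a| k, for one fixed a and all k of size 2^j.
    Since |a| is at least 2^-m0 in the original unit, a window of length q contains at
    most 2^m0 of them. *)
Lemma summed_exp_sum_le j a : (j < N)%N -> (2 ^ (N - m0) <= dist a)%N -> (a < T)%N ->
  \sum_(i < 2 ^ j) sqn (exp_sum wC (dist a * (2 ^ j + i))%N%:R) <=
  2 ^+ 10 * 2 ^+ l.+1 * 2 ^+ m0 * W * (2 * lamC) ^+ j.
Proof.
move=> jN am0 aT; have jN' := ltnW jN.
have a0 : (0 < dist a)%N by rewrite (leq_trans _ am0)// expn_gt0.
under eq_bigr do rewrite -[X in sqn X]/(exp_sum _ _) -[sqn _]mul1r.
apply: le_trans.
  apply: (@large_sieve R Q Q0 _ _ (fun i : 'I_(2 ^ j) => dist a * (2 ^ j + i))%N (fun=> 1)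
    (fun i : 'I_T => nat_of_ord i) (fun i => wC i) q (2 ^ (N - j)) T (T * 2 ^ j)
    (2 ^+ m0) (2 * lamC ^+ j)) => //.
  - by rewrite expn_gt0.
  - move=> i; rewrite TE2 leq_mul ?(dist_le (Ordinal aT))//.
    by rewrite expnS mul2n -addnn leq_add2l ltnW.
  - by move=> i; rewrite ltnW.
  - by rewrite /Q leq_mul// leq_mul.
  - exact: sizes.
  - move=> v; rewrite -natrX.
    apply: le_trans (count_window_le (2 ^ j) (v %/ dist a + 1 - (2 ^ m0 + 2 ^ j)) (2 ^ m0)).
    rewrite [leLHS]big_mkcond [leRHS]big_mkcond /= ler_sum// => i _.
    case: ifP => [/andP[h1 h2]|_]; last by case: ifP.
    rewrite ifT//; rewrite mulnC -leq_divRL// in h1.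
    have h3 : (v %/ dist a < 2 ^ j + i + 2 ^ m0)%N.
      rewrite ltn_divLR// mulnDl (leq_trans h2)// mulnC leq_add2l.
      by rewrite /q -[X in (2 ^ X)%N](subnK m0N) expnD mulnC leq_mul2l am0 orbT.
    by clear -h1 h3; lia.
  - by move=> x; apply: window_le.
rewrite sieve_const//; pose K := 2 ^+ 10 * 2 ^+ l.+1 * 2 ^+ m0 * (2 * lamC) ^+ j.
have K0 : 0 <= K by rewrite !mulr_ge0// ?exprn_ge0// ?mulr_ge0.
rewrite [leRHS](_ : _ = K * W); last by rewrite /K; ring.
rewrite [leLHS](_ : _ = K * \sum_(i < T) wC i) ?ler_wpM2l//.
by rewrite /K !exprMn; ring.
Qed.

Definition product_exp_sum_sqn (k : nat) : R :=
  sqn (\sum_(t : 'I_T * 'I_T * 'I_T) (wA t.1.1 * wB t.1.2 * wC t.2)%:C *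
    chr Q (k%:R * (pos t.1.1 * (pos t.1.2 + pos t.2)))).

(** The transform of the image measure is the alpha-average of a product of
    transforms of beta and gamma; Cauchy-Schwarz separates beta from gamma. *)
Lemma product_exp_sum_sqn_le k : product_exp_sum_sqn k <=
  (\sum_(i < T) wA i * sqn (exp_sum wB (dist i * k)%N%:R)) *
  (\sum_(i < T) wA i * sqn (exp_sum wC (dist i * k)%N%:R)).
Proof.
rewrite /product_exp_sum_sqn.
have -> : \sum_(t : 'I_T * 'I_T * 'I_T) (wA t.1.1 * wB t.1.2 * wC t.2)%:C *
    chr Q (k%:R * (pos t.1.1 * (pos t.1.2 + pos t.2))) =
    \sum_(a < T) (wA a)%:C *
      ((\sum_(b < T) (wB b)%:C * chr Q (k%:R * pos a * pos b)) *
       (\sum_(c < T) (wC c)%:C * chr Q (k%:R * pos a * pos c))).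
  transitivity (\sum_(a < T) \sum_(b < T) \sum_(c < T) (wA a * wB b * wC c)%:C *
    chr Q (k%:R * (pos a * (pos b + pos c)))).
    rewrite pair_big pair_big /=.
    by apply: eq_bigr => -[[a b] c] _.
  apply: eq_bigr => a _; rewrite big_distrlr /= mulr_sumr; apply: eq_bigr => b _.
  rewrite mulr_sumr; apply: eq_bigr => c _.
  by rewrite mulrDr mulrDr !mulrA chrD !rmorphM /=; ring.
apply: le_trans; first by apply: cauchy_schwarz_weighted => i; exact: wA0.
under eq_bigr do rewrite sqn_exp_sum_pos.
by under [X in _ * X <= _]eq_bigr do rewrite sqn_exp_sum_pos.
Qed.

Definition block_const : R :=
  2 ^+ 12 * 2 ^+ l.+1 * W * (2 ^+ 10 * 2 ^+ l.+1 * 2 ^+ m0 * W) * W.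

(** The bound for the factor with beta is uniform in k, so it comes out of the sum,
    and the factor with gamma is summed over k for each a.  This asymmetric use of the
    two sieve bounds is what yields the exponent sA + sB + sC - 2. *)
Lemma product_exp_sum_sqn_block_le j : (j < N)%N ->
  \sum_(i < 2 ^ j) product_exp_sum_sqn (2 ^ j + i) <=
  block_const * (4 * (lamA * lamB * lamC)) ^+ j.
Proof.
move=> jN; pose KB := 2 ^+ 12 * 2 ^+ l.+1 * W * (2 * (lamA * lamB)) ^+ j.
pose KC := 2 ^+ 10 * 2 ^+ l.+1 * 2 ^+ m0 * W * (2 * lamC) ^+ j.
have KB0 : 0 <= KB by rewrite !mulr_ge0// ?exprn_ge0// !mulr_ge0.
have KC0 : 0 <= KC by rewrite !mulr_ge0// ?exprn_ge0// ?mulr_ge0.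
apply: (@le_trans _ _ (KB * \sum_(i < T) wA i *
    \sum_(k < 2 ^ j) sqn (exp_sum wC (dist i * (2 ^ j + k))%N%:R))).
  have -> : \sum_(i < T) wA i *
      \sum_(k < 2 ^ j) sqn (exp_sum wC (dist i * (2 ^ j + k))%N%:R) =
      \sum_(k < 2 ^ j) \sum_(i < T) wA i *
        sqn (exp_sum wC (dist i * (2 ^ j + k))%N%:R).
    by rewrite exchange_big; apply: eq_bigr => i _; rewrite mulr_sumr.
  rewrite mulr_sumr ler_sum// => k _; apply: (le_trans (product_exp_sum_sqn_le _)).
  rewrite ler_wpM2r//; first by apply: sumr_ge0 => i _; rewrite mulr_ge0// sqn_ge0.
  by apply: averaged_exp_sum_le => //; rewrite leq_addr/= expnS mul2n -addnn ltn_add2l.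
apply: (@le_trans _ _ (KB * (KC * W))); last first.
  by rewrite /KB /KC /block_const !exprMn le_eqVlt; apply/orP; left; apply/eqP; 
     rewrite (_ : 4 = 2 * 2) ?exprMn -?natrM//; ring.
rewrite ler_wpM2l// (@le_trans _ _ (KC * \sum_(i < T) wA i))//; last by rewrite ler_wpM2l.
rewrite mulr_sumr ler_sum// => i _; rewrite [KC * _]mulrC.
have [->|wi] := eqVneq (wA i) 0; first by rewrite !mul0r.
by rewrite ler_wpM2l// summed_exp_sum_le// awayA.
Qed.

(** The first term comes from the frequency 0, the second from the geometric series
    over the dyadic blocks. *)
Definition energy_const : R :=
  8 * (W ^+ 6 + block_const / (1 - 4 * (lamA * lamB * lamC))).

Theorem close_pairs_product_le :
  \sum_(t : 'I_T * 'I_T * 'I_T)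
    \sum_(t' : 'I_T * 'I_T * 'I_T |
       `|pos t.1.1 * (pos t.1.2 + pos t.2) -
         pos t'.1.1 * (pos t'.1.2 + pos t'.2)| <= q%:R)
      (wA t.1.1 * wB t.1.2 * wC t.2) * (wA t'.1.1 * wB t'.1.2 * wC t'.2) <=
  energy_const / q%:R.
Proof.
have qr0 : 0 < q%:R :> R by rewrite ltr0n.
apply: le_trans.
  apply: (@close_pairs_le R Q Q0 _
    (fun t : 'I_T * 'I_T * 'I_T => wA t.1.1 * wB t.1.2 * wC t.2)
    (fun t => pos t.1.1 * (pos t.1.2 + pos t.2)) q q%:R) => //.
  - by move=> t; rewrite !mulr_ge0.
  - rewrite -!natrM ler_nat; have : (q <= T)%N by rewrite leq_exp2l// leq_addl.
    by rewrite /Q; move: (T) (q) => a b; clear; nia.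
rewrite -[\sum_(k < q) _]/(\sum_(k < 2 ^ N) product_exp_sum_sqn k).
rewrite /energy_const mulrAC ler_wpM2r ?invr_ge0 ?ler0n// ler_wpM2l//.
rewrite dyadic_blocks_sum lerD//.
  rewrite /product_exp_sum_sqn; under eq_bigr do rewrite mul0r chr0 mulr1.
  rewrite -rmorph_sum sqn_real (exprM W 3 2) ler_pXn2r ?nnegrE//; last 2 first.
  - by apply: sumr_ge0 => t _; rewrite !mulr_ge0.
  - by rewrite exprn_ge0.
  have -> : \sum_(t : 'I_T * 'I_T * 'I_T) wA t.1.1 * wB t.1.2 * wC t.2 =
      (\sum_(a < T) wA a) * (\sum_(b < T) wB b) * (\sum_(c < T) wC c).
    rewrite big_distrlr /= pair_big /= big_distrlr /= pair_big /=.
    by apply: eq_bigr => -[[a b] c] _.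
  rewrite exprS expr2 mulrA ler_pM ?ler_pM//; rewrite ?mulr_ge0//; exact: sumr_ge0.
set z := 4 * _; apply: (@le_trans _ _ (\sum_(j < N) block_const * z ^+ j)).
  by apply: ler_sum => j _; apply: product_exp_sum_sqn_block_le.
rewrite -mulr_sumr ler_wpM2l ?geometric_sum_le//.
  by rewrite /block_const !mulr_ge0// exprn_ge0.
by rewrite /z !mulr_ge0.
Qed.

End Energy.

(** * From energy to Lebesgue measure *)

Section MeasureFromEnergy.
Context {R : realType}.

Lemma grid_cells_measure_le (U : set R) (n : nat) (P : pred 'I_n) (y0 eta u : R) :
  0 < eta -> measurable U -> (lebesgue_measure U <= u%:E)%E ->
  (forall k : 'I_n, P k -> forall x, y0 + k%:R * eta <= x < y0 + k.+1%:R * eta -> U x) ->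
  #|P|%:R * eta <= u.
Proof.
move=> eta0 mU Uu PU.
pose D (k : 'I_n) : set R := `[y0 + k%:R * eta, y0 + k.+1%:R * eta[%classic.
have mD k : measurable (D k) by exact: measurable_itv.
have Dk k : lebesgue_measure (D k) = eta%:E.
  rewrite /D lebesgue_measure_itv /= lte_fin ltrD2l ltr_pM2r// ltr_nat leqnn -EFinB.
  by congr EFin; rewrite -natr1; ring.
have trivD : trivIset setT D.
  apply/trivIsetP => i j _ _ ij; apply/seteqP; split => // x [] /=.
  rewrite /D /= !in_itv /= => /andP[i1 i2] /andP[j1 j2].
  have h1 : (i%:R : R) < j.+1%:R by rewrite -(ltr_pM2r eta0); lra.
  have h2 : (j%:R : R) < i.+1%:R by rewrite -(ltr_pM2r eta0); lra.
  rewrite !ltr_nat in h1 h2; case/negP: ij; rewrite -val_eqE /=; lia.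
rewrite -lee_fin; apply: le_trans Uu.
apply: (@le_trans _ _ (lebesgue_measure (\big[setU/set0]_(i < n | P i) D i))); last first.
  apply: le_measure.
  - rewrite inE; apply: (big_ind (fun E : set R => measurable E)) => //.
    by move=> E F mE mF; exact: measurableU.
  - by rewrite inE.
  - apply: (big_ind (fun E => E `<=` U)); first exact: sub0set.
      by move=> E F EU FU; rewrite subUset.
    by move=> k Pk x; rewrite /D /= in_itv /=; exact: PU.
rewrite measure_bigsetU_ord//.
rewrite (eq_bigr (fun=> eta%:E)) => [|k _]; last exact: Dk.
by rewrite sumEFin lee_fin sumr_const mulr_natl.
Qed.

(** Group the points into cells of length eta.  Cauchy-Schwarz bounds the squared
    mass by the number of cells that carry mass times the sum of the squared masses of
    cells; the cells are disjoint and contained in U, and two points of the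
    same cell are at distance at most eta. *)
Lemma mass_sqr_le_measure_energy (I : finType) (w y : I -> R) (U : set R) (eta u : R) :
  0 < eta -> measurable U -> (lebesgue_measure U <= u%:E)%E ->
  (forall i, 0 <= w i) ->
  (forall i, w i != 0 -> forall x, `|x - y i| <= eta -> U x) ->
  (\sum_i w i) ^+ 2 <=
  u / eta * \sum_i \sum_(j | `|y i - y j| <= eta) w i * w j.
Proof.
move=> eta0 mU Uu w0 wU.
(* a shift that makes all coordinates nonnegative, so that cells are numbered by nat *)
pose Y := \sum_i `|y i|.
have yY i : 0 <= y i + Y.
  have : `|y i| <= Y by rewrite /Y (bigD1 i)//= lerDl sumr_ge0.
  by rewrite ler_norml; lra.
pose b i := Num.truncn ((y i + Y) / eta).
have bP i : (b i)%:R * eta <= y i + Y < (b i).+1%:R * eta.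
  have /andP[h1 h2] := truncn_itv (divr_ge0 (yY i) (ltW eta0)).
  by rewrite -ler_pdivlMr// -ltr_pdivrMr// h1.
pose n := (\max_i b i).+1.
have bn i : (b i < n)%N by rewrite ltnS leq_bigmax.
pose B i := Ordinal (bn i).
pose s k := \sum_(i | B i == k) w i.
pose P k := [exists i, (B i == k) && (w i != 0)].
have sP k : ~~ P k -> s k = 0.
  move=> /existsPn nP; apply: big1 => i Bi; apply/eqP.
  by have := nP i; rewrite Bi /= negbK.
have sumw : \sum_i w i = \sum_k (P k)%:R * s k.
  rewrite (partition_big B xpredT)//=; apply: eq_bigr => k _.
  by have [_|/sP] := boolP (P k); rewrite ?mul1r// /s => ->; rewrite mul0r.
have cs : (\sum_i w i) ^+ 2 <= #|P|%:R * \sum_k s k ^+ 2.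
  rewrite sumw -sqn_real rmorph_sum /=.
  under eq_bigr do rewrite rmorphM /=.
  apply: le_trans.
    by apply: (@sqn_jensen _ _ (fun k => (P k)%:R) (fun k => (s k)%:C%C)) => k.
  rewrite -natr_sum; under [X in X%:R * _]eq_bigr do rewrite -[nat_of_bool _]muln1 mulnbl.
  rewrite -big_mkcond sum1_card ler_wpM2l// ler_sum// => k _.
  by rewrite sqn_real; case: (P k); rewrite ?mul1r ?mul0r ?sqr_ge0.
have Pu : #|P|%:R * eta <= u.
  apply: (grid_cells_measure_le U _ P (- Y) _ _ eta0 mU Uu) => k Pk.
  have [i /andP[/eqP <- wi]] : exists i, (B i == k) && (w i != 0) by apply/existsP.
  move=> x /= /andP[x1 x2]; apply: (wU i wi).
  have /andP[h1 h2] := bP i; rewrite -natr1 mulrDl mul1r in h2 x2.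
  by rewrite ler_norml; lra.
have E : \sum_k s k ^+ 2 <= \sum_i \sum_(j | `|y i - y j| <= eta) w i * w j.
  rewrite [leRHS](partition_big B xpredT)//= ler_sum// => k _.
  rewrite expr2 /s mulr_suml ler_sum// => i /eqP Bi; rewrite mulr_sumr.
  rewrite [leLHS]big_mkcond [leRHS]big_mkcond ler_sum// => j _ /=.
  case: ifP => [/eqP Bj|_]; last by case: ifP => // _; rewrite mulr_ge0.
  rewrite ifT//; have bij : b i = b j by move: Bi; rewrite -Bj => /(congr1 val).
  have /andP[i1 i2] := bP i; have /andP[] := bP j; rewrite -bij => j1 j2.
  rewrite -natr1 mulrDl mul1r in i2 j2.
  by rewrite ler_norml; lra.
apply: (le_trans cs); apply: ler_pM => //; first by apply: sumr_ge0 => k _; exact: sqr_ge0.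
by rewrite ler_pdivlMr.
Qed.

Lemma compact_uniform_nbhs (K U : set R) : compact K -> open U -> K `<=` U ->
  exists2 r : R, 0 < r & forall x y, K x -> `|x - y| < r -> U y.
Proof.
move=> /compact_near_coveringP cK oU KU.
have [] := cK R (0^'+) (fun r x => forall y, `|x - y| < r -> U y) _.
  move=> x Kx.
  have /nbhs_ballP[e /= e0 eU] : nbhs x U by apply: open_nbhs_nbhs; split => //; exact: KU.
  exists (ball x (e / 2), [set r | r < e / 2]) => /=.
    by split; [apply: nbhsx_ballx|apply: nbhs_right_lt]; lra.
  move=> [x' r] /= [xx' re] y x'y; apply: eU; rewrite /ball /=.
  move: xx'; rewrite /ball /= => xx'.
  rewrite -(subrK x' x) -addrA (le_lt_trans (ler_normD _ _))//; lra.
move=> e /= e0 He; exists (e / 2); first by lra.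
move=> x y Kx; apply: (He (e / 2)) => //=; last by lra.
rewrite sub0r normrN gtr0_norm; lra.
Qed.

Lemma compact_bounded_pow2 (K : set R) : compact K ->
  exists l : nat, forall x, K x -> `|x| < (2 ^ l)%:R.
Proof.
move=> /compact_bounded[M0 [_ KM0]]; pose M := M0 + 1.
have KM x : K x -> `|x| <= M by apply: (KM0 M); rewrite /M ltrDl.
exists (Num.truncn `|M|).+1 => x /KM xM.
apply: (le_lt_trans xM); apply: (le_lt_trans (ler_norm M)).
apply: (lt_trans (truncnS_gt _)); rewrite ltr_nat.
exact: ltn_expl.
Qed.

End MeasureFromEnergy.

(** * The set A(B+C) *)

Section ProductSet.
Context {R : realType}.
Implicit Types (A B C : set R).

Lemma mul_add_setE A B C :
  mul_add_set A B C = (fun p => p.1.1 * (p.1.2 + p.2)) @` ((A `*` B) `*` C).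
Proof.
apply/seteqP; split => [_ [a [b [c [Aa Bb Cc ->]]]]|_ [[[a b] c] [[Aa Bb] Cc] <-]].
  by exists ((a, b), c).
by exists a, b, c.
Qed.

Lemma compact_mul_add_set A B C :
  compact A -> compact B -> compact C -> compact (mul_add_set A B C).
Proof.
move=> cA cB cC; rewrite mul_add_setE; apply: continuous_compact; last first.
  by apply: compact_setX => //; exact: compact_setX.
apply: continuous_subspaceT => -[[a b] c] /=.
apply: cvgM.
  apply: (cvg_comp fst fst); exact: cvg_fst.
apply: cvgD; last exact: cvg_snd.
apply: (cvg_comp fst snd); [exact: cvg_fst|exact: cvg_snd].
Qed.

Lemma cell_point_close (l N j : nat) (x : R) : `|x| < (2 ^ l)%:R ->
  j%:R / (2 ^ N)%:R <= x + (2 ^ l)%:R < j.+1%:R / (2 ^ N)%:R ->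
  `|x - grid_pos l N j / (2 ^ N)%:R| <= (2 ^ N)%:R^-1.
Proof.
move=> xl; have q0 : 0 < (2 ^ N)%:R :> R by rewrite ltr0n expn_gt0.
rewrite /grid_pos expnD natrM mulrBl mulfK ?gt_eqF//.
rewrite -natr1 mulrDl mul1r ler_norml; lra.
Qed.

Lemma grid_pos_bound (l N j : nat) : (j < 2 ^ (l.+1 + N))%N ->
  `|grid_pos l N j / (2 ^ N)%:R| <= (2 ^ l)%:R :> R.
Proof.
have q0 : 0 < (2 ^ N)%:R :> R by rewrite ltr0n expn_gt0.
move=> jT; rewrite normrM normfV (ger0_norm (ltW q0)) ler_pdivrMr// -natrM -expnD.
have : j%:R <= (2 ^ (l + N))%:R + (2 ^ (l + N))%:R :> R.
  by rewrite -natrD addnn -mul2n -expnS ler_nat -addSn ltnW.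
by rewrite /grid_pos ler_norml; have := ler0n R j; lra.
Qed.

Lemma product_close (a b c a' b' c' L eta : R) :
  `|a| <= L -> `|b'| <= L -> `|c'| <= L ->
  `|a - a'| <= eta -> `|b - b'| <= eta -> `|c - c'| <= eta ->
  `|a * (b + c) - a' * (b' + c')| <= 4 * L * eta.
Proof.
move=> aL bL cL ae be ce.
have -> : a * (b + c) - a' * (b' + c') =
   a * ((b - b') + (c - c')) + (a - a') * (b' + c') by ring.
have h1 : `|a * ((b - b') + (c - c'))| <= L * (eta + eta).
  by rewrite normrM ler_pM// (le_trans (ler_normD _ _))// lerD.
have h2 : `|(a - a') * (b' + c')| <= eta * (L + L).
  by rewrite normrM ler_pM// (le_trans (ler_normD _ _))// lerD.
by apply: (le_trans (ler_normD _ _)); lra.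
Qed.

(** The cells at distance less than 2^-m0 from 0 lie in two windows of that length,
    whose total mass is at most 4 lam^m0 < h / 2. *)
Lemma away_from_zero (w : nat -> R) (l N m0 : nat) (lam h : R) :
  (m0 <= N)%N -> (forall j, 0 <= w j) ->
  (forall k e, (e <= N)%N -> block_mass (2 ^ (l.+1 + N)) w k e <= lam ^+ (N - e)) ->
  lam ^+ m0 < h / 8 -> h <= \sum_(j < 2 ^ (l.+1 + N)) w j ->
  h / 2 <= \sum_(j < 2 ^ (l.+1 + N))
    (if (2 ^ (N - m0) <= grid_abs l N j)%N then w j else 0).
Proof.
move=> m0N w0 wm lam_lt hw; set T := (2 ^ _)%N; pose half := (2 ^ (l + N))%N.
pose e := (2 ^ (N - m0))%N.
have win a : \sum_(j < T | (a <= j < a + e)%N) w j <= lam ^+ m0 + lam ^+ m0.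
  apply: window_mass_le => // k; have := wm k (N - m0)%N.
  by rewrite subKn ?leq_subr//; apply.
have near0 : \sum_(j < T) (if (e <= grid_abs l N j)%N then 0 else w j) <=
    \sum_(j < T | (half - e <= j < half - e + e)%N) w j +
    \sum_(j < T | (half <= j < half + e)%N) w j.
  rewrite [X in X + _]big_mkcond [X in _ + X]big_mkcond -big_split /= ler_sum// => j _.
  case: ifPn => [_|]; first by rewrite addr_ge0//; case: ifP.
  rewrite -ltnNge /grid_abs -/half => je; have [hj|hj] := leqP half j.
    by rewrite [X in _ <= _ + X]ifT; [rewrite lerDr; case: ifP|clear -je hj; lia].
  by rewrite [X in _ <= X + _]ifT; [rewrite lerDl|clear -je hj; lia].
have split_w : \sum_(j < T) w j =
   \sum_(j < T) (if (e <= grid_abs l N j)%N then w j else 0) +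
   \sum_(j < T) (if (e <= grid_abs l N j)%N then 0 else w j).
  by rewrite -big_split; apply: eq_bigr => j _ /=; case: ifP; rewrite ?addr0 ?add0r.
have := win (half - e)%N; have := win half; move: hw; rewrite split_w -/e; lra.
Qed.

Lemma exponents_below_dims (dA dB dC : R) : 0 <= dA <= 1 -> 0 <= dB <= 1 -> 0 <= dC <= 1 ->
  2 < dA + dB + dC -> exists sA sB sC : R,
  [/\ 0 < sA < dA, 0 < sB < dB, 0 < sC < dC & 2 < sA + sB + sC].
Proof.
move=> hA hB hC h; pose e := (dA + dB + dC - 2) / 4.
by exists (dA - e), (dB - e), (dC - e); rewrite /e; split; lra.
Qed.

Lemma powR2N_lt1 (s : R) : 0 < s -> 2 `^ (- s) < 1 :> R.
Proof.
move=> s0; have ln2 : 0 < ln 2 :> R by rewrite ln_gt0// ltr1n.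
by rewrite /powR pnatr_eq0 /= expR_lt1; nra.
Qed.

Lemma lam_product_lt1 (sA sB sC : R) : 2 < sA + sB + sC ->
  4 * (2 `^ (- sA) * 2 `^ (- sB) * 2 `^ (- sC)) < 1 :> R.
Proof.
move=> h; have -> : 4 = 2 `^ 2 :> R by rewrite powR_mulrn// expr2 -natrM.
rewrite -!powRD ?pnatr_eq0 ?implybT//.
rewrite (_ : 2 + _ = - (sA + sB + sC - 2)); last by ring.
by apply: powR2N_lt1; lra.
Qed.

(** If A(B+C) were null it would lie in an open set U of measure eps, where eps is
    chosen small against the energy constant, which is known before the scale.  Then N
    is taken so large that U contains all points at distance O(2^-N) from A(B+C). *)
Theorem mul_add_set_measure_gt0 A B C : compact A -> compact B -> compact C ->
  (2%:E < hausdorff_dim A + hausdorff_dim B + hausdorff_dim C)%E ->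
  (0 < lebesgue_measure (mul_add_set A B C))%E.
Proof.
move=> cA cB cC dims; rewrite lt_def measure_ge0 andbT; apply/eqP => null.
have cK := compact_mul_add_set _ _ _ cA cB cC; set K := mul_add_set A B C in null cK.
have [l [Al Bl Cl]] : exists l : nat, [/\ forall x, A x -> `|x| < (2 ^ l)%:R,
    forall x, B x -> `|x| < (2 ^ l)%:R & forall x, C x -> `|x| < (2 ^ l)%:R].
  have [l1 h1] := compact_bounded_pow2 _ cA; have [l2 h2] := compact_bounded_pow2 _ cB.
  have [l3 h3] := compact_bounded_pow2 _ cC; exists (maxn l1 (maxn l2 l3)).
  by split => x => [/h1|/h2|/h3] /lt_le_trans; apply;
    rewrite ler_nat leq_exp2l//; lia.
have dim_fin (D : set R) : (forall x, D x -> `|x| < (2 ^ l)%:R) ->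
    exists2 d, hausdorff_dim D = d%:E & 0 <= d <= 1.
  move=> Dl; have := hausdorff_dim_ge0 D; have := hausdorff_dim_le1 _ _ Dl.
  by case: (hausdorff_dim D) => [d| |]//; rewrite !lee_fin => d1 d0; exists d => //; rewrite d0.
have [dA dAE hA] := dim_fin _ Al; have [dB dBE hB] := dim_fin _ Bl.
have [dC dCE hC] := dim_fin _ Cl.
rewrite dAE dBE dCE -!EFinD lte_fin in dims.
have [sA [sB [sC [sA0 sB0 sC0 s2]]]] := exponents_below_dims _ _ _ hA hB hC dims.
(* positive measure in the exponents just below the dimensions *)
have nz (D : set R) (d s : R) : hausdorff_dim D = d%:E -> 0 < s < d ->
    0 <= s /\ hausdorff_measure s D != 0%E.
  move=> dE /andP[s0 sd]; split; first exact: ltW.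
  by apply: hausdorff_measure_neq0; [exact: ltW|rewrite dE lte_fin].
have [sA_ge0 mA] := nz _ _ _ dAE sA0; have [sB_ge0 mB] := nz _ _ _ dBE sB0.
have [sC_ge0 mC] := nz _ _ _ dCE sC0.
have [eA eA0 FA] := discrete_frostman _ _ _ sA_ge0 mA Al.
have [eB eB0 FB] := discrete_frostman _ _ _ sB_ge0 mB Bl.
have [eC eC0 FC] := discrete_frostman _ _ _ sC_ge0 mC Cl.
pose lam (s : R) : R := 2 `^ (- s).
have lam0 s : 0 <= lam s by exact: powR_ge0.
(* m0 fixes how far from 0 the first factor is kept, independently of the scale *)
have [m0 Hm0] : exists m0, forall m, (m0 <= m)%N -> lam sA ^+ m < eA / 8.
  by apply: expr_lt_eps => //; [apply: powR2N_lt1; lra|rewrite divr_gt0].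
pose W : R := (2 ^ l.+1)%:R.
have capW s d : 0 < s < d -> d <= 1 -> W `^ s <= W.
  by move=> sd d1; apply: ler1_powR; [rewrite ler1n expn_gt0|lra].
pose E := energy_const l m0 W (lam sA) (lam sB) (lam sC).
pose H : R := eA / 2 * eB * eC.
have H0 : 0 < H by rewrite !mulr_gt0// divr_gt0.
pose eps := H ^+ 2 / (2 * (`|E| + 1)).
have E1 : 0 < `|E| + 1 by rewrite ltr_wpDl.
have eps0 : 0 < eps by rewrite divr_gt0// ?exprn_gt0// mulr_gt0.
have mK : measurable K by exact: compact_measurable.
have [U [oU KU Ueps]] : exists U, [/\ open U, K `<=` U &
    (lebesgue_measure (U `\` K) < eps%:E)%E].
  have fK : (lebesgue_measure K < +oo)%E by rewrite null ltry.
  exact: lebesgue_regularity_outer mK fK eps0.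
have mU : measurable U by exact: open_measurable.
have Ule : (lebesgue_measure U <= eps%:E)%E.
  rewrite -(setDKU KU) measureU ?setDKI//; last exact: measurableD.
  by rewrite [X in (_ + X)%E]null adde0 ltW.
have [r r0 Hr] := compact_uniform_nbhs _ _ cK oU KU.
pose L : R := (2 ^ l)%:R.
pose N := maxn m0 (Num.truncn ((4 * L + 1) / r)).+1.
pose q : R := (2 ^ N)%:R.
have q0 : 0 < q by rewrite ltr0n expn_gt0.
have qr : (4 * L + 1) / q < r.
  rewrite ltr_pdivrMr// [r * q]mulrC -ltr_pdivrMr//; apply: (lt_trans (truncnS_gt _)).
  by rewrite /q ltr_nat (leq_ltn_trans (leq_maxr m0 _))// ltn_expl.
have m0N : (m0 <= N)%N by rewrite leq_maxl.
have [wA [wA0 wAs wAm wAh wAW]] := FA N.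
have [wB [wB0 wBs wBm wBh wBW]] := FB N.
have [wC [wC0 wCs wCm wCh wCW]] := FC N.
pose wA' j := if (2 ^ (N - m0) <= grid_abs l N j)%N then wA j else 0.
have wA'0 j : 0 <= wA' j by rewrite /wA'; case: ifP.
have wA'le j : wA' j <= wA j by rewrite /wA'; case: ifP.
set T := (2 ^ (l.+1 + N))%N in wAm wAh wAW wBm wBh wBW wCm wCh wCW.
have wA'h : eA / 2 <= \sum_(j < T) wA' j.
  by apply: (away_from_zero _ _ _ _ (lam sA)) => //; exact: Hm0.
have wA'm k e : (e <= N)%N -> block_mass T wA' k e <= lam sA ^+ (N - e).
  by move=> eN; apply: le_trans (wAm k e eN); apply: ler_sum.
have wA'W : \sum_(j < T) wA' j <= W.
  apply: (@le_trans _ _ (\sum_(j < T) wA j)); first exact: ler_sum.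
  exact: le_trans wAW (capW _ _ sA0 (andP hA).2).
have wBW' := le_trans wBW (capW _ _ sB0 (andP hB).2).
have wCW' := le_trans wCW (capW _ _ sC0 (andP hC).2).
have wA'far j : wA' j != 0 -> (2 ^ (N - m0) <= grid_abs l N j)%N.
  by rewrite /wA'; case: ifP => //; rewrite eqxx.
have energy := @close_pairs_product_le R l N m0 W (lam sA) (lam sB) (lam sC)
  wA' wB wC wA'0 wB0 wC0 (lam0 _) (lam0 _) (lam0 _) wA'm wBm wCm wA'W wBW' wCW'
  m0N wA'far (lam_product_lt1 _ _ _ s2).
pose p j : R := grid_pos l N j / q.
pose w (t : 'I_T * 'I_T * 'I_T) := wA' t.1.1 * wB t.1.2 * wC t.2.
pose y (t : 'I_T * 'I_T * 'I_T) := p t.1.1 * (p t.1.2 + p t.2).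
have w0 t : 0 <= w t by rewrite !mulr_ge0.
(* a cell of positive weight meets the set, so that y t is within 4 L / q of A(B+C) *)
have wU t : w t != 0 -> forall x, `|x - y t| <= q^-1 -> U x.
  rewrite !mulf_eq0 !negb_or => /andP[/andP[nA nB] nC] x xy.
  have {}nA : wA t.1.1 != 0 by move: nA; rewrite /wA'; case: ifP => //; rewrite eqxx.
  have [a Aa /(cell_point_close _ _ _ _ (Al _ Aa)) aE] := wAs _ nA.
  have [b Bb /(cell_point_close _ _ _ _ (Bl _ Bb)) bE] := wBs _ nB.
  have [c Cc /(cell_point_close _ _ _ _ (Cl _ Cc)) cE] := wCs _ nC.
  apply: (Hr (a * (b + c))); first by exists a, b, c.
  have close : `|a * (b + c) - y t| <= 4 * L * q^-1.
    by apply: product_close => //; [apply: ltW; exact: Al|exact: grid_pos_bound..].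
  rewrite -(subrK (y t) (a * (b + c))) -addrA (le_lt_trans (ler_normD _ _))//.
  apply: le_lt_trans qr; rewrite mulrDl mul1r lerD//.
  by rewrite distrC.
have qV0 : 0 < q^-1 by rewrite invr_gt0.
have := mass_sqr_le_measure_energy _ w y U _ _ qV0 mU Ule w0 wU.
(* the unit of length changes from 1 to 1 / q ^ 2 *)
have same t t' : (`|y t - y t'| <= q^-1) =
    (`|grid_pos l N t.1.1 * (grid_pos l N t.1.2 + grid_pos l N t.2) -
       grid_pos l N t'.1.1 * (grid_pos l N t'.1.2 + grid_pos l N t'.2)| <= q).
  rewrite /y /p; move: (grid_pos l N t.1.1) (grid_pos l N t.1.2) (grid_pos l N t.2).
  move: (grid_pos l N t'.1.1) (grid_pos l N t'.1.2) (grid_pos l N t'.2).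
  move=> a' b' c' a b c.
  rewrite (_ : _ - _ = (a * (b + c) - a' * (b' + c')) * (q^-1 * q^-1)); last by ring.
  rewrite normrM (ger0_norm (ltW (mulr_gt0 qV0 qV0))).
  by rewrite -ler_pdivlMr ?mulr_gt0// invfM invrK mulKf// gt_eqF.
under [X in _ <= _ * X]eq_bigr => t _ do under eq_bigl => t' do rewrite same.
have Hw : H <= \sum_t w t.
  have -> : \sum_t w t =
      (\sum_(a < T) wA' a) * (\sum_(b < T) wB b) * (\sum_(c < T) wC c).
    rewrite big_distrlr /= pair_big /= big_distrlr /= pair_big /=.
    by apply: eq_bigr => -[[a b] c] _.
  by rewrite /H !ler_pM// ?mulr_ge0// ltW// divr_gt0.
have H2 : H ^+ 2 <= (\sum_t w t) ^+ 2.
  by rewrite ler_pXn2r ?nnegrE ?sumr_ge0// ltW.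
rewrite invrK => sqr_le; have {sqr_le}/(le_trans H2) := sqr_le.
apply/negP; rewrite -ltNge.
have epsq : 0 <= eps * q by rewrite mulr_ge0// ltW.
apply: (le_lt_trans (ler_wpM2l epsq energy)).
have -> : eps * q * (E / q) = eps * E by field; rewrite gt_eqF.
have epsE : eps * (`|E| + 1) = H ^+ 2 / 2 by rewrite /eps; field; rewrite gt_eqF.
have : eps * E <= eps * `|E| by rewrite ler_wpM2l ?ler_norm// ltW.
have : 0 < H ^+ 2 by rewrite exprn_gt0.
move: epsE eps0; rewrite mulrDr mulr1.
by move: (eps * `|E|) (eps * E) (H ^+ 2) => e1 e2 e3; clear; lra.
Qed.

Theorem exists_null_mul_add_set_dim2 :
  exists A B C : set R,
    [/\ compact A, compact B & compact C] /\
    (hausdorff_dim A + hausdorff_dim B + hausdorff_dim C = 2%:E)%E /\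
    lebesgue_measure (mul_add_set A B C) = 0%E.
Proof.
exists [set 0], `[0%R, 1%R]%classic, `[0%R, 1%R]%classic; split.
  by split; [exact: compact_set1|exact: segment_compact..].
split.
  rewrite hausdorff_dim_point hausdorff_dim_unit_interval add0e -EFinD.
  by congr EFin; ring.
rewrite (_ : mul_add_set _ _ _ = [set 0]) ?lebesgue_measure_set1//.
apply/seteqP; split => [_ [a [b [c [-> _ _ ->]]]]|_ ->]; first by rewrite mul0r.
exists 0, 0, 0; split; rewrite /= ?in_itv /= ?lexx ?ler01 ?mul0r//.
Qed.

End ProductSet.

Theorem corollary1p5 (R : realType) :
  (forall A B C : set R,
      compact A -> compact B -> compact C ->
      (2%:E < hausdorff_dim A + hausdorff_dim B + hausdorff_dim C)%E ->
      (0 < lebesgue_measure (mul_add_set A B C))%E) /\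
  (exists A B C : set R,
      [/\ compact A, compact B & compact C] /\
      (hausdorff_dim A + hausdorff_dim B + hausdorff_dim C = 2%:E)%E /\
      lebesgue_measure (mul_add_set A B C) = 0%E).
Proof.
split; last exact: exists_null_mul_add_set_dim2.
exact: mul_add_set_measure_gt0.
Qed.
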